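(* Let $\mathfrak{A}_E=(\mathfrak{M}_E,m)$ be a representable arithmetic matroid of rank $r=\mathrm{rk}(E)$, represented by a finite list $E$ of elements of a finitely generated abelian group $G$ whose rank equals $\mathrm{rk}(E)$, and let $\mathcal{T}_E$ be the associated generalized toric arrangement. Write its characteristic polynomial as \[ \chi(\mathcal{T}_E;t)=a_0t^r+a_1t^{r-1}+a_2t^{r-2}+\cdots+a_{r-1}t+a_r. \] Then $(-1)^{k}a_k\geq 0$ and $(-1)^{k}\sum_{i=0}^{k}a_i\geq 0$ for all $0\leq k\leq r$.
   Context: Let $E$ be a finite list of elements of a finitely generated abelian group $G$. For a sublist $A\subseteq E$, let $\langle A\rangle$ be the subgroup generated by $A$, let $\mathrm{rk}(A)$ be the rank of the abelian group $\langle A\rangle$, and let $m(A)$ be the cardinality of the torsion subgroup of $G/\langle A\rangle$. Then $(E,\mathrm{rk},m)$ is an arithmetic matroid; arithmetic matroids arising in this way are called representable, and one always assumes that $\mathrm{rk}(E)$ equals the rank of $G$. The associated generalized toric arrangement is $\mathcal{T}_E=\{H_\lambda:\lambda\in E\}$ on $T=\mathrm{Hom}(G,\mathbb{C}^* )$, where $H_\lambda=\{t\in T:\lambda(t)=1\}$ (with $\lambda(t):=t(\lambda)$). Let $\mathcal{C}(\mathcal{T}_E)$ be the set of all connected components of all nonempty intersections of the subvarieties $H_\lambda$ (including the empty intersection $T$), ordered by reverse inclusion, with Möbius function $\mu$. For $C\in\mathcal{C}(\mathcal{T}_E)$ let $T_C$ be the connected component of $T$ containing $C$. The characteristic polynomial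 is $\chi(\mathcal{T}_E;t)=\sum_{C\in\mathcal{C}(\mathcal{T}_E)}\mu(T_C,C)\,t^{\dim C}$. *)

(* Defs.v *)
From HB Require Import structures.
From mathcomp Require Import all_boot all_order all_algebra.
From mathcomp Require Import all_classical all_reals all_analysis.
From mathcomp Require Import complex.

Set Implicit Arguments.
Unset Strict Implicit.
Unset Printing Implicit Defensive.

Import Order.TTheory GRing.Theory Num.Theory.
Import numFieldNormedType.Exports.

Local Open Scope classical_set_scope.
Local Open Scope card_scope.
Local Open Scope ring_scope.

Section AbelianGroups.
Variable G : zmodType.

Definition spanZ n (s : n.-tuple G) (A : {set 'I_n}) : set G :=
  [set g | exists c : 'I_n -> int, g = \sum_(i in A) tnth s i *~ c i].

Definition fin_generated : Prop :=
  exists n (s : n.-tuple G), spanZ s [set: 'I_n]%SET = [set: G].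

Definition freeZ n (s : n.-tuple G) : Prop :=
  forall c : 'I_n -> int,
    \sum_(i < n) tnth s i *~ c i = 0 -> forall i, c i = 0.

(* [r] is the rank of the subgroup [H]: the maximal number of Z-linearly
   independent elements of [H]. *)
Definition is_rank (H : set G) (r : nat) : Prop :=
  (exists2 s : r.-tuple G, freeZ s & forall i, H (tnth s i)) /\
  (forall n (s : n.-tuple G), freeZ s -> (forall i, H (tnth s i)) ->
     (n <= r)%N).

Definition torsion_quotient (H : set G) : set (set G) :=
  [set X | exists2 g, exists2 k, (0 < k)%N & H (g *+ k)
                    & X = [set h | H (h - g)]].

(* The list [E] represents the arithmetic matroid on the ground set ['I_n] with
   rank function [rk] and multiplicity function [m]. *)
Definition represents n (E : n.-tuple G) (rk m : {set 'I_n} -> nat) : Prop :=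
  forall A : {set 'I_n}, is_rank (spanZ E A) (rk A) /\
                         torsion_quotient (spanZ E A) #= `I_(m A).

End AbelianGroups.

Section Mobius.
Variable T : choiceType.

(* [mu] is the Moebius function of [L] ordered by reverse inclusion. *)
Definition is_mobius (L : set (set T)) (mu : set T -> set T -> int) : Prop :=
  forall X Y, L X -> L Y -> Y `<=` X ->
    \sum_(Z \in [set Z | L Z /\ Y `<=` Z /\ Z `<=` X]) mu X Z = (X == Y)%:R.

(* For finite [L] such a function exists, and its values at pairs X, Y in L with
   Y included in X are determined; only those values are used below. *)
Definition mobius (L : set (set T)) : set T -> set T -> int :=
  xget (fun _ _ => 0) (is_mobius L).

End Mobius.

Section ToricArrangement.
Variables (R : realType) (G : zmodType).

(* All functions from [G] to the complex numbers, with the topology of pointwise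
   convergence; it induces on Hom(G, C^* ) its usual (analytic) topology. *)
Definition ambient := {ptws G -> (R[i] : numFieldType)}.

Definition torus : set ambient :=
  [set t | (forall g, t g != 0) /\ (forall g h, t (g + h) = t g * t h)].

(* The regular functions on the torus are the linear combinations of the
   characters t |-> t g; [p] lists the coefficients and exponents. *)
Definition regular (p : seq (R[i] * G)) (t : ambient) : R[i] :=
  \sum_(u <- p) u.1 * t u.2.

Definition zariski_closed (Z : set ambient) : Prop :=
  exists F : set (seq (R[i] * G)),
    Z = [set t | torus t /\ forall p, F p -> regular p t = 0].

Definition zariski_irreducible (Z : set ambient) : Prop :=
  Z !=set0 /\
  forall Z1 Z2, zariski_closed Z1 -> zariski_closed Z2 ->
    Z `<=` Z1 `|` Z2 -> Z `<=` Z1 \/ Z `<=` Z2.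

Definition has_chain (C : set ambient) (d : nat) : Prop :=
  exists Z : nat -> set ambient,
    (forall i, (i <= d)%N ->
       [/\ zariski_closed (Z i), zariski_irreducible (Z i) & Z i `<=` C]) /\
    (forall i, (i < d)%N -> Z i `<` Z i.+1).

(* Krull dimension of a subvariety of the torus. *)
Definition dim (C : set ambient) : nat :=
  xget 0%N [set d | has_chain C d /\ forall e, has_chain C e -> (e <= d)%N].

Variables (n : nat) (E : n.-tuple G).

Definition hypersurface (lambda : G) : set ambient :=
  [set t | torus t /\ t lambda = 1].

Definition intersection (A : {set 'I_n}) : set ambient :=
  [set t | torus t /\ forall i, i \in A -> hypersurface (tnth E i) t].

Definition layers : set (set ambient) :=
  [set C | exists A : {set 'I_n}, exists2 t, intersection A t
                                & C = connected_component (intersection A) t].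

(* For connected nonempty [C] this is the connected component of the torus
   containing [C]. *)
Definition torus_component (C : set ambient) : set ambient :=
  \bigcup_(t in C) connected_component torus t.

(* The set of layers is finite, so the sum below has finite support. *)
Definition toric_char_poly : {poly int} :=
  \sum_(C \in layers) mobius layers (torus_component C) C *: 'X^(dim C).

End ToricArrangement.

(* Main.v *)
(** The layers below a component of the torus are the cosets [u + L], where [L]
    consists of the characters trivial on the saturation [K] of the subgroup
    generated by a sublist. Evaluating the Moebius function by inclusion-exclusion
    over sublists writes the characteristic polynomial, one component of the torus
    at a time, as the sum over [A] of [(-1)^#|A|] times the number of components
    of the intersection over [A] times [X^(r - rk A)].

    Deleting and contracting an element that is not needed to span [G] up to
    finite index preserves the sign pattern of the partial sums. Passing to the
    components of the hypersurface keeps every intermediate ambient variety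
    connected, so a character that becomes constant either kills the polynomial
    or can be dropped. When no element is redundant, the components over [A] are
    counted by the elements, supported in [A], of a finite abelian group, and the
    polynomial is the sum of [(-1)^#|supp g| (X - 1)^(r - #|supp g|)] over that
    group.

    The Krull dimension of a coset is found by counting: the monomials in [m]
    functions separating a chain of length [m] are linearly independent, while
    products of boundedly many Laurent monomials in [d] variables span a space
    that grows only with exponent [d]. *)
Require Import Defs.
From HB Require Import structures.
From mathcomp Require Import all_boot all_order all_algebra.
From mathcomp Require Import all_classical all_reals all_analysis.
From mathcomp Require Import complex separable cyclotomic zify ring.

Set Implicit Arguments.
Unset Strict Implicit.
Unset Printing Implicit Defensive.

Import Order.TTheory GRing.Theory Num.Theory.
Local Open Scope ring_scope.

Import numFieldNormedType.Exports.
Local Open Scope classical_set_scope.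

(** * Saturated subgroups and bases modulo them *)

Section Subgroups.
Variable G : zmodType.
Implicit Types (K : set G) (x y : G).

(** Quotients of [G] are never formed: every ambient variety is a coset of a saturated subgroup [K]
    of one fixed [G], and contraction only enlarges [K]. Saturation is what makes these cosets
    connected.

    The induction has to carry the hypothesis that the list spans up to finite index: for the empty
    list in rank 1 the polynomial is X, whose partial sum for k = 1 has the wrong sign. Deletion can
    destroy this hypothesis, which is why only redundant elements are deleted and the remaining case
    is counted directly.

    In that count the factor X - 1 makes the partial sums tractable. Multiplication by it takes
    differences of consecutive coefficients, so the partial sums of (X - 1)^j are coefficients of (X
    - 1)^(j - 1); for j = 0 only the last partial sum is nonzero. *)

Definition subgroup K := K 0 /\ forall x y, K x -> K y -> K (x - y).

Definition saturated K :=
  subgroup K /\ forall x k, (0 < k)%N -> K (x *+ k) -> K x.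

Lemma subgroup0 K : subgroup K -> K 0. Proof. by case. Qed.

Lemma subgroupB K x y : subgroup K -> K x -> K y -> K (x - y).
Proof. by case=> _; apply. Qed.

Lemma subgroupN K x : subgroup K -> K x -> K (- x).
Proof. by move=> [K0 KB] Kx; rewrite -sub0r; exact: KB. Qed.

Lemma subgroupD K x y : subgroup K -> K x -> K y -> K (x + y).
Proof.
by move=> sK Kx Ky; rewrite -[y]opprK; apply: subgroupB => //; exact: subgroupN.
Qed.

Lemma subgroupMn K x k : subgroup K -> K x -> K (x *+ k).
Proof.
move=> sK Kx; elim: k => [|k IHk]; first by rewrite mulr0n; exact: subgroup0.
by rewrite mulrS; exact: subgroupD.
Qed.

Lemma subgroupMz K x (k : int) : subgroup K -> K x -> K (x *~ k).
Proof.
move=> sK Kx; case: k => k; first by rewrite -pmulrn; exact: subgroupMn.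
by rewrite NegzE mulrNz -pmulrn; apply: subgroupN => //; exact: subgroupMn.
Qed.

Lemma subgroup_sum K (I : Type) (s : seq I) (P : pred I) (f : I -> G) :
  subgroup K -> (forall i, P i -> K (f i)) -> K (\sum_(i <- s | P i) f i).
Proof.
move=> sK Kf; elim/big_ind: _ => //; first exact: subgroup0.
by move=> x y; exact: subgroupD.
Qed.

Lemma subgroupDl K x y : subgroup K -> K x -> (K (x + y) <-> K y).
Proof.
move=> sK Kx; split=> [Kxy|]; last exact: subgroupD.
by rewrite -(addKr x y) addrC; exact: subgroupB.
Qed.

Lemma subgroup_congr K x y : subgroup K -> K (x - y) -> (K x <-> K y).
Proof. by move=> sK Kxy; rewrite -{1}(subrK y x); exact: subgroupDl. Qed.

Lemma saturatedMz K x (k : int) : saturated K -> k != 0 -> K (x *~ k) -> K x.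
Proof.
move=> [sK satK] k0 Kx; apply: (satK x `|k|%N); first by rewrite absz_gt0.
rewrite pmulrn; case: (intP k) Kx => [|m|m] Kx //.
by rewrite abszN -[_ *~ _]opprK -mulrNz; exact: subgroupN.
Qed.

(** A basis of the quotient of [G] by [K], expressed in [G]; the function [c] records a choice of
    coordinates. *)
Definition is_basis K d (e : 'I_d -> G) (c : G -> 'I_d -> int) :=
  (forall x, K (x - \sum_i e i *~ c x i)) /\
  (forall c' : 'I_d -> int, K (\sum_i e i *~ c' i) -> forall i, c' i = 0).

Let gens K d (e : 'I_d -> G) :=
  forall x, exists c : 'I_d -> int, K (x - \sum_i e i *~ c i).

Lemma fin_generated_gens K : subgroup K -> fin_generated G ->
  exists d (e : 'I_d -> G), gens K e.
Proof.
move=> sK [d [s sG]]; exists d, (tnth s) => x.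
have : [set: G] x by [].
rewrite -sG => -[c ->]; exists c.
by rewrite (eq_bigl xpredT) ?subrr; [exact: subgroup0|move=> i; rewrite inE].
Qed.

Let shear_sum d (e : 'I_d -> G) (i j : 'I_d) (s : int) (a : 'I_d -> int) :
  i != j ->
  \sum_k e k *~ a k =
  \sum_k (if k == j then e j + e i *~ s else e k) *~
          (if k == i then a i - s * a j else a k).
Proof.
move=> ij; rewrite (bigD1 j) //= [RHS](bigD1 j) //= eqxx.
rewrite [j == i]eq_sym (negbTE ij) (bigD1 i) //= [in RHS](bigD1 i) //= eqxx.
rewrite (negbTE ij) mulrzDl mulrzBr -mulrzA [_ - e i *~ _]addrC.
rewrite -!addrA addNKr; congr (_ + (_ + _)).
by apply: eq_bigr => k /andP[/negbTE kj /negbTE ki]; rewrite kj ki.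
Qed.

Let gens_shear K d (e : 'I_d -> G) (i j : 'I_d) (s : int) : i != j ->
  gens K e -> gens K (fun k => if k == j then e j + e i *~ s else e k).
Proof.
move=> ij eG x; have [a Ka] := eG x.
by exists (fun k => if k == i then a i - s * a j else a k); rewrite -shear_sum.
Qed.

(* The Euclidean algorithm on the coefficients of a relation, carried out by
   changes of generators, ends with a relation that has a single nonzero
   coefficient; saturation then makes one generator redundant. *)
Let relation_drop K d (e : 'I_d -> G) (c : 'I_d -> int) : saturated K ->
  gens K e -> K (\sum_i e i *~ c i) -> (exists i, c i != 0) ->
  exists d' (e' : 'I_d' -> G), (d' < d)%N /\ gens K e'.
Proof.
move=> satK; have sK := satK.1.
have [w] := ubnP (\sum_i `|c i|%N); elim: w e c => // w IHw e c wc eG Kc [i ci].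
have [[j /andP[ij cj]]|nj] := pselect (exists j, (i != j) && (c j != 0)).
  have shear i' j' : i' != j' -> c i' != 0 -> c j' != 0 ->
      (`|c j'| <= `|c i'|)%N ->
      exists d' (e' : 'I_d' -> G), (d' < d)%N /\ gens K e'.
    move=> ij' ci' cj' le.
    (* This sign makes the new coefficient have absolute value [|c i'| - |c j'|], so the sum of
       absolute values drops. *)
    pose s : int := if (0 < c i') == (0 < c j') then 1 else -1.
    apply: (IHw _ (fun k => if k == i' then c i' - s * c j' else c k)).
    - apply: leq_trans (_ : \sum_i0 `|c i0|%N <= w)%N => //.
      rewrite [X in (_ < X)%N](bigD1 i') //= (bigD1 i') //= eqxx.
      rewrite (eq_bigr (fun k => `|c k|%N)); last by move=> k /negbTE ->.
      by rewrite ltn_add2r /s; case: ifP => h; lia.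
    - exact: gens_shear ij' eG.
    - by rewrite -shear_sum.
    - by exists j'; rewrite [j' == i']eq_sym (negbTE ij').
  have [le|/ltnW le] := leqP `|c j|%N `|c i|%N; first exact: (shear i j).
  by apply: (shear j i) => //; rewrite eq_sym.
have c0 k : k != i -> c k = 0.
  by move=> ki; apply/eqP/negPn/negP => ck; apply: nj; exists k; rewrite eq_sym ki.
have Kei : K (e i).
  apply: (saturatedMz satK ci).
  move: Kc; rewrite (bigD1 i) //= big1 ?addr0 // => k ki.
  by rewrite c0 // mulr0z.
case: d {IHw} e c wc eG Kc i ci nj c0 Kei => [|d] e c wc eG Kc i ci nj c0 Kei.
  by case: i ci nj c0 Kei.
exists d, (fun k => e (lift i k)); split=> // x; have [a Ka] := eG x.
exists (fun k => a (lift i k)).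
have -> : x - \sum_k e (lift i k) *~ a (lift i k) =
          (x - \sum_k e k *~ a k) + e i *~ a i.
  by rewrite (bigD1_ord i) //= opprD addrA addrAC subrK.
by apply: subgroupD => //; exact: subgroupMz.
Qed.

(** A generating family of least length is free modulo [K], since [relation_drop] would shorten it
    along any nonzero relation. *)
Lemma basis_exists K : saturated K -> fin_generated G ->
  exists d (e : 'I_d -> G) c, is_basis K e c.
Proof.
move=> satK /(fin_generated_gens satK.1) exG.
have [d [e eG] dmin] : exists2 d, exists e : 'I_d -> G, gens K e &
    forall d' (e' : 'I_d' -> G), gens K e' -> (d <= d')%N.
  have exP : exists d, `[< exists e : 'I_d -> G, gens K e >].
    by have [d [e eG]] := exG; exists d; apply/asboolP; exists e.
  case: (ex_minnP exP) => d /asboolP deG dmin; exists d => // d' e' eG'.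
  by apply: dmin; apply/asboolP; exists e'.
have [c cP] := choice eG.
exists d, e, c; split=> // c' Kc' i; apply/eqP/negPn/negP => c'i.
have [|d' [e' [dd' eG']]] := relation_drop satK eG Kc'; first by exists i.
by move: dd'; rewrite ltnNge (dmin _ _ eG').
Qed.

Section Coordinates.
Variables (K : set G) (d : nat) (e : 'I_d -> G) (c : G -> 'I_d -> int).
Hypotheses (sK : subgroup K) (bK : is_basis K e c).

Lemma coord_uniq x (a : 'I_d -> int) :
  K (x - \sum_i e i *~ a i) -> c x =1 a.
Proof.
move=> Ka i; apply/eqP; rewrite -subr_eq0; apply/eqP.
apply: (bK.2 (fun i => c x i - a i)).
have -> : \sum_j e j *~ (c x j - a j) =
    (x - \sum_i e i *~ a i) - (x - \sum_i e i *~ c x i).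
  by rewrite opprB addrC subrKA -sumrB; apply: eq_bigr => j _; rewrite mulrzBr.
by apply: subgroupB => //; exact: bK.1.
Qed.

Lemma coordB x y i : c (x - y) i = c x i - c y i.
Proof.
apply: (coord_uniq (a := fun i => c x i - c y i)).
have -> : x - y - \sum_j e j *~ (c x j - c y j) =
    (x - \sum_i e i *~ c x i) - (y - \sum_i e i *~ c y i).
  rewrite (eq_bigr (fun j => e j *~ c x j - e j *~ c y j)); last first.
    by move=> j _; rewrite mulrzBr.
  by rewrite sumrB !opprB addrACA [RHS]addrACA [- y - _]addrC.
by apply: subgroupB => //; exact: bK.1.
Qed.

Lemma coord0 i : c 0 i = 0.
Proof. by rewrite -(subrr 0) coordB subrr. Qed.

Lemma coordN x i : c (- x) i = - c x i.
Proof. by rewrite -sub0r coordB coord0 sub0r. Qed.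

Lemma coordD x y i : c (x + y) i = c x i + c y i.
Proof. by rewrite -{1}[y]opprK coordB coordN opprK. Qed.

Lemma coordMn x k i : c (x *+ k) i = c x i *+ k.
Proof. by elim: k => [|k IHk]; rewrite ?mulr0n ?coord0 // !mulrS coordD IHk. Qed.

Lemma coordMz x k i : c (x *~ k) i = c x i * k.
Proof.
case: k => k; first by rewrite -pmulrn coordMn -mulr_natr natz.
by rewrite NegzE mulrNz -pmulrn coordN coordMn -mulr_natr natz mulrN.
Qed.

Lemma coord_basis i j : c (e i) j = (i == j)%:R.
Proof.
apply: (coord_uniq (a := fun j => (i == j)%:R)).
rewrite (bigD1 i) //= eqxx mulr1z big1 ?addr0 ?subrr; first exact: subgroup0.
by move=> k /negbTE ki; rewrite eq_sym ki mulr0z.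
Qed.

Lemma coord_eq0P x : K x <-> forall i, c x i = 0.
Proof.
split=> [Kx i|c0].
  by apply: (coord_uniq (a := fun=> 0)); rewrite big1 ?subr0.
by have := bK.1 x; rewrite big1 ?subr0 // => j _; rewrite c0 mulr0z.
Qed.

End Coordinates.

(* The proof takes the largest [p] such that [x] is [p] times an element
   modulo [K]. *)
Lemma primitive_root K x : saturated K -> fin_generated G -> ~ K x ->
  exists kappa p, [/\ (0 < p)%N, K (x - kappa *+ p) &
    forall y, (exists2 k, (0 < k)%N & exists a, K (y *+ k - x *~ a)) ->
      exists a, K (y - kappa *~ a)].
Proof.
move=> satK fgG nKx; have sK := satK.1.
have [d [e [c bK]]] := basis_exists satK fgG.
have [i ci] : exists i, c x i != 0.
  apply: contrapT => nc; apply: nKx; apply/(coord_eq0P sK bK) => i.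
  by apply/eqP/negPn/negP => ci; apply: nc; exists i.
pose P p := `[< (0 < p)%N /\ exists kappa, K (x - kappa *+ p) >].
have exP : exists p, P p.
  by exists 1%N; apply/asboolP; split=> //; exists x; rewrite subrr; exact: sK.1.
(* Any such [p] divides the nonzero coordinate [c x i], which bounds it. *)
have bP p : P p -> (p <= `|c x i|)%N.
  case/asboolP => p0 [kappa Kk].
  have : c (x - kappa *+ p) i = 0 by have /(coord_eq0P sK bK) := Kk.
  rewrite (coordB sK bK) (coordMn sK bK) => /eqP; rewrite subr_eq0 => /eqP cx.
  apply: dvdn_leq; first by rewrite absz_gt0.
  by rewrite cx -mulr_natr abszM natz absz_nat dvdn_mull.
case: (ex_maxnP exP bP) => p /asboolP[p0 [kappa Kk]] pmax.
exists kappa, p; split=> // y [k k0 [a Kya]].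
(* after cancelling the common factor of [k] and [a * p] *)
have [k' [a' [u [v [k'0 Kya' uv]]]]] : exists (k' : nat) (a' u v : int),
    [/\ (0 < k')%N, K (y *+ k' - kappa *~ a') & u * k' + v * a' = 1].
  have [u [v uv]] := Bezoutz k (a * p).
  set g := gcdz k (a * p) in uv.
  have g0 : g != 0 by rewrite gcdz_eq0; apply/negP => /andP[]; lia.
  have gk : (k %/ g)%Z * g = k by rewrite divzK // dvdz_gcdl.
  have ga : (a * p %/ g)%Z * g = a * p by rewrite divzK // dvdz_gcdr.
  have gp : 0 < g by rewrite lt0r g0.
  have kg : 0 <= (k %/ g)%Z by rewrite divz_ge0.
  exists `|(k %/ g)%Z|%N, (a * p %/ g)%Z, u, v; split.
  - rewrite absz_gt0; apply/negP => /eqP h; move: gk; rewrite h mul0r; lia.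
  - apply: (saturatedMz satK g0).
    rewrite mulrzBl -mulrzA ga [y *+ _]pmulrn.
    rewrite -mulrzA gez0_abs // gk.
    have -> : y *~ k - kappa *~ (a * p) =
        (y *+ k - x *~ a) + (x - kappa *+ p) *~ a.
      rewrite mulrzBl addrA subrK [y *+ k]pmulrn [kappa *+ p]pmulrn -mulrzA.
      by rewrite [p%:Z * _]mulrC.
    by apply: subgroupD => //; exact: subgroupMz.
  - rewrite gez0_abs //; apply: (mulIf g0).
    rewrite mul1r -[RHS]uv; move: gk ga; clearbody g; clear.
    by move: (divz _ _) (divz _ _) => q1 q2 e1 e2; rewrite -e2 -e1; ring.
(* Modulo [K], [y *+ k'] equals [kappa *~ a'], so the Bezout relation makes [kappa] equal to
   [kappa' *+ k']. Then [x] is [p * k'] times an element, and maximality of [p] forces [k' = 1]. *)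
pose kappa' := kappa *~ u + y *~ v.
have Kk' : K (kappa - kappa' *+ k').
  have -> : kappa - kappa' *+ k' = - ((y *+ k' - kappa *~ a') *~ v).
    rewrite /kappa' pmulrn mulrzDl -!mulrzA mulrzBl -mulrzA pmulrn -mulrzA.
    rewrite -{1}[kappa]mulr1z -uv mulrzDr [v * a']mulrC [v * k']mulrC.
    by rewrite opprD addrACA subrr add0r opprB.
  by apply: subgroupN => //; exact: subgroupMz.
have : P (p * k')%N.
  apply/asboolP; split; first by rewrite muln_gt0 p0.
  exists kappa'; have -> : x - kappa' *+ (p * k') =
      (x - kappa *+ p) + (kappa - kappa' *+ k') *+ p.
    by rewrite mulrnBl addrA subrK -mulrnA mulnC.
  by apply: subgroupD => //; exact: subgroupMn.
move=> /pmax; rewrite -{2}[p]muln1 leq_pmul2l // => k'1.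
have {}k'1 : k' = 1%N by lia.
by exists a'; move: Kya'; rewrite k'1 mulr1n.
Qed.

End Subgroups.

(** * Saturated closures of sublists over a base subgroup *)

Section Closure.
Variables (G : zmodType) (n : nat) (lam : 'I_n -> G).
Implicit Types (K : set G) (A B : {set 'I_n}).

Definition span_mod K A : set G :=
  [set x | exists c : 'I_n -> int, K (x - \sum_(i in A) lam i *~ c i)].

(* The saturation of the subgroup generated by [K] and the [lam i], i in A. *)
Definition cl K A : set G :=
  [set x | exists2 k, (0 < k)%N & span_mod K A (x *+ k)].

Lemma subgroup_span K A : subgroup K -> subgroup (span_mod K A).
Proof.
move=> sK; split.
  by exists (fun=> 0); rewrite big1 ?subrr; [exact: sK.1|].
move=> x y [c Kx] [c' Ky]; exists (fun i => c i - c' i).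
rewrite (eq_bigr (fun i => lam i *~ c i - lam i *~ c' i)); last first.
  by move=> i _; rewrite mulrzBr.
have := subgroupB sK Kx Ky.
by rewrite sumrB !opprB addrACA [- _ + - y]addrC -addrACA.
Qed.

Lemma sub_span K A : K `<=` span_mod K A.
Proof.
by move=> x Kx; exists (fun=> 0); rewrite big1 ?subr0.
Qed.

Lemma mem_span K A i : subgroup K -> i \in A -> span_mod K A (lam i).
Proof.
move=> sK iA; exists (fun j => (j == i)%:R).
rewrite (bigD1 i) //= eqxx mulr1z big1 ?addr0 ?subrr; first exact: sK.1.
by move=> j /andP[_ /negbTE ->]; rewrite mulr0z.
Qed.

Lemma span_cl K A : span_mod K A `<=` cl K A.
Proof. by move=> x Kx; exists 1%N. Qed.

Lemma cl_saturated K A : subgroup K -> saturated (cl K A).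
Proof.
move=> sK; have sS := subgroup_span A sK; split.
  split; first by apply: span_cl; exact: sS.1.
  move=> x y [k k0 Kx] [l l0 Ky]; exists (k * l)%N; first by rewrite muln_gt0 k0.
  rewrite mulrnBl mulrnA [(k * l)%N]mulnC mulrnA.
  by apply: subgroupB => //; exact: subgroupMn.
move=> x k k0 [l l0 Kx]; exists (k * l)%N; first by rewrite muln_gt0 k0.
by rewrite mulrnA.
Qed.

Lemma sub_cl K A : K `<=` cl K A.
Proof. by move=> x /sub_span /span_cl. Qed.

Lemma mem_cl K A i : subgroup K -> i \in A -> cl K A (lam i).
Proof. by move=> sK iA; apply: span_cl; exact: mem_span. Qed.

Lemma span_min K K' A : subgroup K' -> K `<=` K' ->
  (forall i, i \in A -> K' (lam i)) -> span_mod K A `<=` K'.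
Proof.
move=> sK' KK' AK' x [c /KK' Kx].
rewrite -[x](subrK (\sum_(i in A) lam i *~ c i)); apply: subgroupD => //.
by apply: subgroup_sum => // i /AK'; exact: subgroupMz.
Qed.

Lemma cl_min K K' A : saturated K' -> K `<=` K' ->
  (forall i, i \in A -> K' (lam i)) -> cl K A `<=` K'.
Proof.
move=> [sK' satK'] KK' AK' x [k k0 /(span_min sK' KK' AK')].
exact: satK'.
Qed.

Lemma cl_sub K K' A B : subgroup K' -> K `<=` cl K' B -> A \subset B ->
  cl K A `<=` cl K' B.
Proof.
move=> sK' KK' /fintype.subsetP AB; apply: cl_min => //; first exact: cl_saturated.
by move=> i /AB; exact: mem_cl.
Qed.

Lemma cl_cl K A B : subgroup K -> cl (cl K A) B = cl K (A :|: B)%SET.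
Proof.
move=> sK; have sA := (cl_saturated A sK).1; apply/seteqP; split.
  apply: cl_sub => //; last exact: finset.subsetUr.
  by apply: cl_sub; rewrite ?finset.subsetUl //; exact: sub_cl.
apply: cl_min; first exact: cl_saturated.
  exact: subset_trans (@sub_cl _ _) (@sub_cl _ _).
move=> i; rewrite inE => /orP[iA|iB]; last exact: mem_cl.
by apply: sub_cl; exact: mem_cl.
Qed.

Lemma cl_set0 K : saturated K -> cl K finset.set0 = K.
Proof.
move=> satK; apply/seteqP; split; last exact: sub_cl.
by apply: cl_min => // i; rewrite inE.
Qed.

Lemma cl_set1P K i x : cl K [set i]%SET x <->
  exists2 k, (0 < k)%N & exists a : int, K (x *+ k - lam i *~ a).
Proof.
split=> -[k k0 [c Kc]]; exists k => //.
  by exists (c i); move: Kc; rewrite big_set1.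
by exists (fun=> c); rewrite big_set1.
Qed.

Lemma cl_mem K A : saturated K -> (forall i, i \in A -> K (lam i)) ->
  cl K A = K.
Proof.
move=> satK KA; apply/seteqP; split; last exact: sub_cl.
exact: cl_min.
Qed.

End Closure.

(** * Characters and cosets, with coordinates on a coset *)

Section Torus.
Variables (R : realType) (G : zmodType).
Local Notation C := (R[i]).
Implicit Types (t u : ambient R G) (K : set G).

Lemma torus_neq0 t x : torus t -> t x != 0. Proof. by case. Qed.

Lemma torusD t x y : torus t -> t (x + y) = t x * t y. Proof. by case. Qed.

Lemma torus0 t : torus t -> t 0 = 1.
Proof.
move=> tT; apply: (mulIf (torus_neq0 0 tT)); rewrite mul1r -torusD //.
by rewrite addr0.
Qed.

Lemma torusN t x : torus t -> t (- x) = (t x)^-1.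
Proof.
move=> tT; apply: (mulIf (torus_neq0 x tT)); rewrite mulVf ?torus_neq0 //.
by rewrite -torusD // addNr torus0.
Qed.

Lemma torusB t x y : torus t -> t (x - y) = t x / t y.
Proof. by move=> tT; rewrite torusD // torusN. Qed.

Lemma torusMn t x k : torus t -> t (x *+ k) = t x ^+ k.
Proof.
move=> tT; elim: k => [|k IHk]; first by rewrite mulr0n torus0.
by rewrite mulrS torusD // IHk exprS.
Qed.

Lemma torusMz t x (k : int) : torus t -> t (x *~ k) = t x ^ k.
Proof.
move=> tT; case: k => k; first by rewrite -pmulrn torusMn.
by rewrite NegzE mulrNz -pmulrn torusN // torusMn.
Qed.

Lemma torus_sum t (I : Type) (s : seq I) (P : pred I) (f : I -> G) : torus t ->
  t (\sum_(i <- s | P i) f i) = \prod_(i <- s | P i) t (f i).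
Proof.
move=> tT; elim/big_rec2: _ => [|i x y _ <-]; first exact: torus0.
by rewrite torusD.
Qed.

(* The characters of [G] that agree with [t] on [K]; when [K] is saturated and
   [t] is a character, this is a translate of a connected subtorus. *)
Definition coset K t : set (ambient R G) :=
  [set u | torus u /\ forall x, K x -> u x = t x].

Lemma coset_refl K t : torus t -> coset K t t. Proof. by []. Qed.

Lemma coset_eq K t u : coset K t u -> coset K u = coset K t.
Proof.
move=> [uT ut]; apply/seteqP; split=> v [vT vu]; split=> // x Kx.
  by rewrite vu // ut.
by rewrite vu // ut.
Qed.

Lemma coset_sub K K' t : K' `<=` K -> coset K t `<=` coset K' t.
Proof. by move=> KK' u [uT ut]; split=> // x /KK'; exact: ut. Qed.

Section Coordinates.
Variables (K : set G) (d : nat) (e : 'I_d -> G) (c : G -> 'I_d -> int).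
Hypotheses (sK : subgroup K) (bK : is_basis K e c).

(** The point of the coset of [t] with coordinates [w]: the correcting factor depends only on the
    coordinates of [x], hence is 1 on [K], and it replaces the value [t (e i)] by [w i]. *)
Definition twist t (w : 'I_d -> C) : ambient R G :=
  fun x => t x * \prod_i (w i / t (e i)) ^ c x i.

Lemma torus_twist t w : torus t -> (forall i, w i != 0) -> torus (twist t w).
Proof.
move=> tT w0; have r0 i : w i / t (e i) != 0.
  by rewrite mulf_neq0 ?invr_eq0 ?torus_neq0.
split=> [x|x y]; rewrite /twist.
  by rewrite mulf_neq0 ?torus_neq0 //; apply/prodf_neq0 => i _; rewrite expfz_neq0.
rewrite torusD // mulrACA -big_split /=; congr (_ * _); apply: eq_bigr => i _.
by rewrite (coordD sK bK) expfzDr.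
Qed.

Lemma coset_twist t w : torus t -> (forall i, w i != 0) ->
  coset K t (twist t w).
Proof.
move=> tT w0; split=> [|x Kx]; first exact: torus_twist.
rewrite /twist big1 ?mulr1 // => i _.
by have /(coord_eq0P sK bK) -> := Kx; rewrite expr0z.
Qed.

Lemma twist_basis t w i : torus t -> twist t w (e i) = w i.
Proof.
move=> tT; rewrite /twist (bigD1 i) //= (coord_basis sK bK) eqxx expr1z.
rewrite big1 ?mulr1; first by rewrite mulrC divfK ?torus_neq0.
by move=> j /negbTE ji; rewrite (coord_basis sK bK) eq_sym ji expr0z.
Qed.

(** The difference of [x] and its expansion in the basis lies in [K], where [u] and [t] agree. *)
Lemma coset_expand t u x : torus t -> coset K t u ->
  u x = t x * \prod_i (u (e i) / t (e i)) ^ c x i.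
Proof.
move=> tT [uT ut]; have := ut _ (bK.1 x); rewrite !torusB // !torus_sum //.
rewrite !(eq_bigr _ (fun i _ => torusMz _ _ _)) // => h.
rewrite (eq_bigr (fun i => u (e i) ^ c x i / t (e i) ^ c x i)); last first.
  by move=> i _; rewrite expfzMl exprz_inv invr_expz.
rewrite prodf_div mulrA mulrAC -[t x / _]h divfK //.
by apply/prodf_neq0 => i _; rewrite expfz_neq0 ?torus_neq0.
Qed.

End Coordinates.

Lemma exprz2_eq1 (k : int) : (2 : C) ^ k = 1 -> k = 0.
Proof.
have h m : (2 : C) ^+ m.+1 <> 1.
  by move=> /eqP; rewrite pexpr_eq1 // ?pnatr_eq1 // ler0n.
case: k => [[|m]|m] //; first by move/h.
by rewrite NegzE -exprnN => /eqP; rewrite invr_eq1 => /eqP /h.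
Qed.

(** Doubling the value of [t] at a basis element along which [x] has a nonzero coordinate multiplies
    [t x] by a nonzero power of 2. *)
Lemma coset_separates K t x : saturated K -> fin_generated G -> torus t ->
  ~ K x -> exists2 u, coset K t u & u x != t x.
Proof.
move=> satK fgG tT nKx; have sK := satK.1.
have [d [e [c bK]]] := basis_exists satK fgG.
have [i ci] : exists i, c x i != 0.
  apply: contrapT => nc; apply: nKx; apply/(coord_eq0P sK bK) => i.
  by apply/eqP/negPn/negP => ci; apply: nc; exists i.
pose w j := t (e j) * (if j == i then 2 else 1).
have w0 j : w j != 0.
  by rewrite mulf_neq0 ?torus_neq0 //; case: ifP; rewrite ?pnatr_eq0 ?oner_neq0.
exists (twist e c t w); first exact: coset_twist.
apply/negP => /eqP; rewrite /twist (bigD1 i) //= big1 ?mulr1 => [|j /negbTE ji].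
  rewrite /w eqxx [t (e i) * _]mulrC mulfK ?torus_neq0 // => h.
  move/eqP: ci; apply; apply: exprz2_eq1.
  by apply: (mulfI (torus_neq0 x tT)); rewrite mulr1.
by rewrite /w ji mulr1 divff ?torus_neq0 // exp1rz.
Qed.

End Torus.

(** * Connectedness of the cosets of a saturated subgroup *)

Section Connectedness.
Variables (R : realType) (G : zmodType).
Local Notation C := ((R[i] : numFieldType)).
Implicit Types (t u : ambient R G) (K : set G).

Lemma continuous_real_complex : continuous (fun s : R => (s%:C)%C : C).
Proof.
move=> z; apply/cvgrPdist_lt => e; case: e => a b.
rewrite ltcE /= => /andP[/eqP -> a0].
apply: filterS (nbhsx_ballx z _ a0) => t zt.
by rewrite -rmorphB normc_def /= expr0n addr0 sqrtr_sqr ltcR.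
Qed.

Lemma continuous_ambient (T : topologicalType) (f : T -> ambient R G) s :
  (forall x, {for s, continuous (fun s => f s x : C)}) ->
  {for s, continuous f}.
Proof.
move=> cf; apply/cvg_sup => x A.
have /= -> := @nbhsE (initial_topology (fun t : ambient R G => t x : C)) (f s).
case=> _ [[B oB <-] /= Bfs] /filterS; apply.
by apply: (cf x); apply: open_nbhs_nbhs.
Qed.

Lemma continuous_eval x : continuous (fun t : ambient R G => t x : C).
Proof. exact: (@proj_continuous G (fun _ => C) x). Qed.

Lemma continuous_prod (T : topologicalType) (I : Type) (s : seq I)
    (f : I -> T -> C) z :
  (forall i, {for z, continuous (f i)}) ->
  {for z, continuous (fun y => \prod_(i <- s) f i y)}.
Proof.
move=> cf; elim: s => [|i s IHs].
  rewrite (_ : (fun _ => _) = fun=> 1); first exact: cvg_cst.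
  by apply/funext => y; rewrite big_nil.
rewrite (_ : (fun _ => _) = fun y => f i y * \prod_(j <- s) f j y).
  by apply: cvgM; [exact: cf|exact: IHs].
by apply/funext => y; rewrite big_cons.
Qed.

Lemma continuous_exprz (T : topologicalType) (f : T -> C) (k : int) z :
  f z != 0 -> {for z, continuous f} -> {for z, continuous (fun s => f s ^ k)}.
Proof.
move=> fz cf.
have cX m : {for z, continuous (fun s => f s ^+ m)}.
  rewrite (_ : (fun s => f s ^+ m) = (fun s => \prod_(i <- iota 0 m) f s)).
    exact: continuous_prod.
  by apply/funext => s; rewrite big_const_seq count_predT size_iota iter_mulr_1.
case: k => m; first exact: cX.
have -> : (fun s => f s ^ Negz m) = (fun s => (f s ^+ m.+1)^-1) by [].
by apply: cvgV; [rewrite expf_neq0|exact: cX].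
Qed.

(* A path from [1] to [z] in the punctured plane: the bump [s (1 - s)] is added
   to the imaginary part on the side of [z]. *)
Let path (z : C) (s : R) : C :=
  Complex (1 - s + s * complex.Re z)
          (s * complex.Im z + (if 0 <= complex.Im z then s * (1 - s) else - (s * (1 - s)))).

Let path_neq0 (z : C) (s : R) : z != 0 -> 0 <= s <= 1 -> path z s != 0.
Proof.
case: z => a b z0 /andP[s0 s1]; apply/negP => /eqP [] /=.
have [->|s0'] := eqVneq s 0; first by rewrite subr0 mul0r addr0 => /eqP; rewrite oner_eq0.
have [->|s1'] := eqVneq s 1.
  rewrite subrr add0r !mul1r oppr0 if_same addr0 => a0 b0; move/eqP: z0; apply.
  by rewrite a0 b0.
have {}s0 : 0 < s by rewrite lt0r s0' s0.
have {}s1 : s < 1 by rewrite lt_neqAle s1' s1.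
move=> _; have sp : 0 < s * (1 - s) by rewrite mulr_gt0 // subr_gt0.
case: (leP 0 b) => b0 /eqP.
  by apply/negP; rewrite gt_eqF // ltr_wpDl // mulr_ge0 // ltW.
have sb : s * b < 0 by rewrite pmulr_rlt0.
by apply/negP; rewrite lt_eqF // subr_lt0; exact: lt_trans sb sp.
Qed.

Let path0 z : path z 0 = 1.
Proof. by rewrite /path !mul0r oppr0 if_same !addr0. Qed.

Let path1 z : path z 1 = z.
Proof.
by rewrite /path subrr !mul1r oppr0 if_same addr0 add0r; case: z.
Qed.

Let continuous_path z : continuous (path z).
Proof.
pose g (s : R) : R := s * complex.Im z + (if 0 <= complex.Im z then s * (1 - s) else - (s * (1 - s))).
have -> : path z = fun s =>
    ((1 - s + s * complex.Re z)%:C)%C + 'i%C * ((g s)%:C)%C :> C.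
  apply/funext => s; rewrite /path /g; simpc; apply/eqP; rewrite eq_complex /=.
  by rewrite !eqxx.
have cg : continuous g.
  move=> s; rewrite /g; apply: cvgD; first by apply: cvgMl; exact: cvg_id.
  have c2 : (fun y : R => y * (1 - y)) @ s --> s * (1 - s).
    by apply: cvgM; [exact: cvg_id|apply: cvgB; [exact: cvg_cst|exact: cvg_id]].
  by case: ifP => _ //; apply: cvgN.
move=> s; apply: cvgD.
  apply: (@continuous_comp _ _ _ (fun s : R => 1 - s + s * complex.Re z) (fun s : R => (s%:C)%C : C)).
    apply: cvgD; first by apply: cvgB; [exact: cvg_cst|exact: cvg_id].
    by apply: cvgMl; exact: cvg_id.
  exact: continuous_real_complex.
apply: cvgMr.
apply: (@continuous_comp _ _ _ g (fun s : R => (s%:C)%C : C)); first exact: cg.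
exact: continuous_real_complex.
Qed.

(** In the coordinates of a basis the coset is a power of the punctured plane. A point [v] is joined
    to [t] by moving all the ratios [v (e i) / t (e i)] simultaneously along their paths from 1. *)
Lemma coset_connected K t : saturated K -> fin_generated G -> torus t ->
  connected (coset K t).
Proof.
move=> satK fgG tT; have sK := satK.1.
have [d [e [c bK]]] := basis_exists satK fgG.
suff <- : connected_component (coset K t) t = coset K t.
  exact: component_connected.
apply/seteqP; split; first exact: connected_component_sub.
move=> v cv; pose r i := v (e i) / t (e i).
have r0 i : r i != 0.
  by rewrite mulf_neq0 ?invr_eq0 ?torus_neq0 //; exact: cv.1.
pose w s i := t (e i) * path (r i) s.
pose g (s : R) : ambient R G := twist e c t (w s).
have w0 s : 0 <= s <= 1 -> forall i, w s i != 0.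
  by move=> s01 i; apply: mulf_neq0; [exact: torus_neq0|exact: path_neq0].
have gE s x : g s x = t x * \prod_i path (r i) s ^ c x i.
  rewrite /g /twist; congr (_ * _); apply: eq_bigr => i _.
  by rewrite /w [t _ * _]mulrC mulfK ?torus_neq0.
have conn : connected [set g s | s in `[0, 1]].
  apply: connected_continuous_connected; first exact: segment_connected.
  apply: continuous_in_subspaceT => s /set_mem /=; rewrite in_itv /= => s01.
  apply: continuous_ambient => x.
  rewrite (_ : (fun s => g s x) =
    fun s => t x * \prod_i path (r i) s ^ c x i); last first.
    by apply/funext => s'; rewrite gE.
  apply: cvgMr; apply: continuous_prod => i; apply: continuous_exprz.
    exact: path_neq0.
  exact: continuous_path.
apply: (@connected_component_max _ (coset K t) [set g s | s in `[0, 1]]) => //.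
- exists 0; first by rewrite /= in_itv /= lexx ler01.
  apply/funext => x; rewrite gE big1 ?mulr1 // => i _.
  by rewrite path0 exp1rz.
- move=> _ [s + <-]; rewrite /= in_itv /= => s01.
  by apply: coset_twist => //; exact: w0.
- exists 1; first by rewrite /= in_itv /= lexx ler01.
  apply/funext => x; rewrite gE (coset_expand bK x tT cv).
  by congr (_ * _); apply: eq_bigr => i _; rewrite path1.
Qed.

End Connectedness.

(** * Connected components of the intersections *)

Section Components.
Variables (R : realType) (G : zmodType) (n : nat) (E : n.-tuple G).
Hypothesis fgG : fin_generated G.
Local Notation C := ((R[i] : numFieldType)).
Local Notation lam := (tnth E).
Implicit Types (t u : ambient R G) (A : {set 'I_n}).

Definition tors : set G := [set x | exists2 k, (0 < k)%N & x *+ k = 0].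

Lemma tors_saturated : saturated tors.
Proof.
split; first split.
- by exists 1%N.
- move=> x y [k k0 kx] [l l0 ly]; exists (k * l)%N; first by rewrite muln_gt0 k0.
  by rewrite mulrnBl mulrnA kx mul0rn mulnC mulrnA ly mul0rn subr0.
- move=> x k k0 [l l0 kx]; exists (k * l)%N; first by rewrite muln_gt0 k0.
  by rewrite mulrnA.
Qed.

Lemma intersectionP A t :
  intersection E A t <-> torus t /\ forall i, i \in A -> t (lam i) = 1.
Proof.
split=> -[tT tA]; split=> // i iA; first by have [] := tA i iA.
by split=> //; exact: tA.
Qed.

(* Powers of the elements of [cl tors A] lie in the subgroup generated by the
   [lam i], where the characters in the intersection are trivial. *)
Lemma intersection_root_of_unity A x : cl lam tors A x ->
  exists2 k, (0 < k)%N & forall t, intersection E A t -> t x ^+ k = 1.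
Proof.
move=> [k k0 [c [l l0 kx]]]; exists (k * l)%N; first by rewrite muln_gt0 k0.
move=> t /intersectionP[tT tA].
rewrite -torusMn // mulrnA; move/eqP: kx; rewrite mulrnBl subr_eq0 => /eqP ->.
rewrite torusMn // torus_sum // big1 ?expr1n // => i iA.
by rewrite torusMz // tA // exp1rz.
Qed.

Lemma coset_intersection A t : intersection E A t ->
  coset (cl lam tors A) t `<=` intersection E A.
Proof.
move=> /intersectionP[tT tA] u [uT ut]; apply/intersectionP; split=> // i iA.
by rewrite ut ?tA //; apply: mem_cl => //; exact: tors_saturated.1.
Qed.

Lemma finite_roots_of_unity k : (0 < k)%N -> finite_set [set z : C | z ^+ k = 1].
Proof.
move=> k0; have p0 : ('X^k - 1 : {poly R[i]}) != 0.
  by rewrite -size_poly_eq0 size_XnsubC.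
have [r pr] := closed_field_poly_normal ('X^k - 1 : {poly R[i]}).
apply: (@sub_finite_set _ _ [set` r]); last exact: finite_seq.
move=> z /= zk; have : root ('X^k - 1) z by rewrite rootE !hornerE zk subrr.
by rewrite pr rootZ ?lead_coef_eq0 // root_prod_XsubC.
Qed.

(** On the intersection, an element of the closure takes values in a finite set of roots of unity.
    The points of the component where it has the value [t x] thus form an open and closed part, so
    it is constant there. Conversely the coset is connected and contained in the intersection. *)
Lemma component_intersection A t : intersection E A t ->
  connected_component (intersection E A) t = coset (cl lam tors A) t.
Proof.
move=> tA; have tT : torus t by have /intersectionP[] := tA.
have satK := cl_saturated lam A tors_saturated.1.
apply/seteqP; split; last first.
  apply: connected_component_max => //; first exact: coset_intersection.
  exact: coset_connected.
move=> u tu; have uA := connected_component_sub tu.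
split; first by have /intersectionP[] := uA.
move=> x Kx; have [k k0 xk] := intersection_root_of_unity Kx.
set D := connected_component _ _ in tu.
have DA : D `<=` intersection E A by exact: connected_component_sub.
suff DE : [set v | D v /\ v x = t x] = D by have : D u by []; rewrite -DE => -[].
have cev := @continuous_eval R G x.
have acc := (accessible_finite_set_closed.1
  (hausdorff_accessible (@norm_hausdorff _ C))).
apply: (component_connected (A := intersection E A) (x := t)).
- by exists t; split=> //; exact: connected_component_refl.
- exists ((fun v : ambient R G => v x : C) @^-1`
    (~` ([set z : C | z ^+ k = 1] `\ t x))).
    apply: open_comp => //; rewrite openC; apply: acc.
    by apply: finite_setD; exact: finite_roots_of_unity.
  apply/seteqP; split=> v [Dv vx]; split=> //=; first by rewrite vx => -[].
  apply: contrapT => ne; apply: vx; split; last exact: ne.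
  by apply: xk; exact: DA.
- exists ((fun v : ambient R G => v x : C) @^-1` [set t x]).
    by apply: closed_comp => //; apply: acc; exact: finite_set1.
  by apply/seteqP; split=> v [].
Qed.

End Components.

(** * Linear relations and nonroots of polynomials *)

Section Counting.

Lemma linear_relation (F : fieldType) (I J : finType) (A : I -> J -> F) :
  (#|J| < #|I|)%N ->
  exists2 c : I -> F, exists i, c i != 0 & forall j, \sum_i c i * A i j = 0.
Proof.
move=> ltJI; pose M := \matrix_(i < #|I|, j < #|J|) A (enum_val i) (enum_val j).
have /rowV0Pn[v /sub_kermxP vM v0] : kermx M != 0.
  rewrite -mxrank_eq0 mxrank_ker subn_eq0 -ltnNge.
  by apply: leq_ltn_trans ltJI; exact: rank_leq_col.
exists (fun i => v 0 (enum_rank i)).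
  have /existsP[i vi] : [exists i, v 0 i != 0].
    apply: contraNT v0 => /existsPn v0; apply/eqP/rowP => i; rewrite mxE.
    by apply/eqP; have := v0 i; rewrite negbK.
  by exists (enum_val i); rewrite enum_valK.
move=> j; have := congr1 (fun w : 'rV[F]_#|J| => w 0 (enum_rank j)) vM.
rewrite !mxE => vMj; rewrite -[RHS]vMj (reindex (@enum_val I predT)) /=; last first.
  by exists enum_rank => i _; [exact: enum_valK|exact: enum_rankK].
by apply: eq_bigr => i _; rewrite !mxE enum_valK enum_rankK.
Qed.

Lemma poly_nonroot (F : numFieldType) (p : {poly F}) : p != 0 ->
  exists s, p.[s] != 0.
Proof.
move=> p0; apply: contrapT => np.
have := @max_poly_roots _ p [seq i%:R | i <- iota 0 (size p)] p0.
rewrite size_map size_iota ltnn => h; suff: false by [].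
apply: h; last by rewrite map_inj_uniq ?iota_uniq // => i j /eqP; rewrite eqr_nat => /eqP.
apply/allP => _ /mapP[i _ ->]; apply/negPn/negP => ni.
by apply: np; exists i%:R.
Qed.

End Counting.

(** * Zariski closedness and irreducibility of cosets *)

Section Dimension.
Variables (R : realType) (G : zmodType).
Local Notation C := (R[i]).
Implicit Types (t u v : ambient R G) (K : set G) (p q : seq (R[i] * G)).

Lemma regular_nil u : regular [::] u = 0.
Proof. by rewrite /regular big_nil. Qed.

Lemma regular_cons a p u : regular (a :: p) u = a.1 * u a.2 + regular p u.
Proof. by rewrite /regular big_cons. Qed.

Lemma regular_cat p q u : regular (p ++ q) u = regular p u + regular q u.
Proof. by rewrite /regular big_cat. Qed.

Definition regular_mul p q : seq (R[i] * G) :=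
  [seq (a.1 * b.1, a.2 + b.2) | a <- p, b <- q].

Lemma regular_mulE p q u : torus u ->
  regular (regular_mul p q) u = regular p u * regular q u.
Proof.
move=> uT; rewrite /regular /regular_mul big_allpairs_dep /= big_distrl /=.
apply: eq_bigr => a _; rewrite big_distrr /=; apply: eq_bigr => b _.
by rewrite torusD // mulrACA.
Qed.

Lemma zero_set_closed p : zariski_closed [set u | torus u /\ regular p u = 0].
Proof.
exists [set p]; apply/seteqP; split=> u [uT pu]; split=> //.
  by move=> _ ->.
exact: pu.
Qed.

Lemma coset_closed K t : torus t -> zariski_closed (coset K t).
Proof.
move=> tT.
exists [set p | exists2 x, K x & p = [:: (1, x); (- t x, 0)]].
have E u x : torus u -> regular [:: (1, x); (- t x, 0)] u = u x - t x.
  by move=> uT; rewrite !regular_cons regular_nil /= torus0 // mul1r mulr1 addr0.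
apply/seteqP; split=> u [uT uP]; split=> //.
  by move=> _ [x Kx ->]; rewrite E // uP // subrr.
move=> x Kx; apply/eqP; rewrite -subr_eq0 -E //; apply/eqP.
by apply: uP; exists x.
Qed.

Section Coordinates.
Variables (K : set G) (d : nat) (e : 'I_d -> G) (c : G -> 'I_d -> int).
Hypotheses (satK : saturated K) (bK : is_basis K e c).
Variable t : ambient R G.
Hypothesis tT : torus t.
Let sK := satK.1.

Section Line.
Variables (a b : 'I_d -> C).

Let l (i : 'I_d) : {poly C} := (a i)%:P + (b i - a i) *: 'X.
Let w (s : C) (i : 'I_d) := (l i).[s].
Let Q := \prod_i l i.

(** Along the line from [a] to [b] a regular function is a Laurent polynomial in the coordinates
    [l i]; a power of their product [Q] clears the negative exponents. *)
Let regular_line p : exists P N, forall s, (forall i, w s i != 0) ->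
  regular p (twist e c t (w s)) * Q.[s] ^+ N = P.[s].
Proof.
elim: p => [|[z x] p [P [N IHp]]].
  by exists 0, 0%N => s _; rewrite regular_nil mul0r horner0.
pose M := (\max_i `|c x i|)%N.
pose P1 := (z * t x * \prod_i (t (e i))^-1 ^ c x i) *: \prod_i l i ^+ `|(c x i + M%:Z)%R|%N.
exists (P1 * Q ^+ N + P * Q ^+ M), (M + N)%N => s ws.
rewrite regular_cons /= mulrDl hornerD !hornerM !horner_exp -IHp //.
rewrite exprD; congr (_ + _); last by rewrite -mulrA [X in _ * X]mulrC.
rewrite mulrA; congr (_ * _); rewrite /P1 hornerZ /twist /Q !horner_prod.
have gen (z1 t1 p1 q1 p2 q2 : C) :
    p1 * q1 = p2 * q2 -> z1 * (t1 * p1) * q1 = z1 * t1 * p2 * q2.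
  by move=> h; rewrite mulrA -!mulrA h.
rewrite -prodrXl; apply: gen.
rewrite -big_split -[RHS]big_split; apply: eq_bigr => i _ /=.
rewrite -/(w s i) expfzMl mulrC mulrA [RHS]mulrC horner_exp; congr (_ * _).
have cM : 0 <= c x i + M%:Z.
  have : (`|c x i|%N <= M)%N by exact: (leq_bigmax i).
  lia.
rewrite exprnP -expfzDr // exprnP gez0_abs //; congr (_ ^ _); lia.
Qed.

(** The numerators of [p] and [q] along the line are nonzero because of its two ends. A point
    outside the roots of their product with [Q] stays in the coset and avoids both zero sets, so
    irreducibility is reduced to polynomials in one variable. *)
Lemma line_avoids p q : (forall i, a i != 0) -> (forall i, b i != 0) ->
  regular p (twist e c t a) != 0 -> regular q (twist e c t b) != 0 ->
  exists2 u, coset K t u & regular p u != 0 /\ regular q u != 0.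
Proof.
move=> a0 b0 pa qb.
have w0 : w 0 = a by apply/funext => i; rewrite /w /l hornerD hornerZ hornerC hornerX mulr0 addr0.
have w1 : w 1 = b by apply/funext => i; rewrite /w /l hornerD hornerZ hornerC hornerX mulr1 addrC subrK.
have [P [N PE]] := regular_line p; have [P' [N' PE']] := regular_line q.
have Q0 : Q.[0] != 0.
  by rewrite horner_prod; apply/prodf_neq0 => i _; rewrite -/(w 0 i) w0.
have Q1 : Q.[1] != 0.
  by rewrite horner_prod; apply/prodf_neq0 => i _; rewrite -/(w 1 i) w1.
have nz (P1 : {poly C}) s : P1.[s] != 0 -> P1 != 0.
  by apply: contraNneq => ->; rewrite horner0.
have [s] : exists s, (P * P' * Q).[s] != 0.
  apply: poly_nonroot; rewrite !mulf_neq0 //; last exact: nz Q0.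
    apply: (nz _ 0); rewrite -PE; last by move=> i; rewrite w0.
    by rewrite w0; exact: mulf_neq0 pa (expf_neq0 _ Q0).
  apply: (nz _ 1); rewrite -PE'; last by move=> i; rewrite w1.
  by rewrite w1; exact: mulf_neq0 qb (expf_neq0 _ Q1).
rewrite !hornerM !mulf_eq0 !negb_or => /andP[/andP[Ps P's] Qs].
have ws i : w s i != 0.
  by move: Qs; rewrite horner_prod => /prodf_neq0; apply.
exists (twist e c t (w s)); first exact: coset_twist.
split.
  by apply: contraNneq Ps => p0; rewrite -PE // p0 mul0r.
by apply: contraNneq P's => p0; rewrite -PE' // p0 mul0r.
Qed.

End Line.

(** If neither closed set contained the coset, each would have an equation that is nonzero somewhere
    on it, and [line_avoids] would give a point outside both. *)
Lemma coset_irreducible : zariski_irreducible (coset K t).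
Proof.
split; first by exists t.
move=> _ _ [F1 ->] [F2 ->] sub12.
have [s1|/existsNP[u /not_implyP[cu nu]]] :=
  pselect (coset K t `<=` [set u | torus u /\ forall p, F1 p -> regular p u = 0]).
  by left.
right => v cv; apply: contrapT => nv.
have [p1 F1p pu] : exists2 p, F1 p & regular p u != 0.
  apply: contrapT => np; apply: nu; split; first exact: cu.1.
  by move=> p F1p; apply/eqP/negPn/negP => pu; apply: np; exists p.
have [q1 F2q qv] : exists2 p, F2 p & regular p v != 0.
  apply: contrapT => np; apply: nv; split; first exact: cv.1.
  by move=> p F2p; apply/eqP/negPn/negP => pv; apply: np; exists p.
have tw z : coset K t z -> z = twist e c t (fun i => z (e i)).
  by move=> cz; apply/funext => x; exact: (coset_expand bK).
have [z cz [pz qz]] : exists2 z, coset K t z & regular p1 z != 0 /\ regular q1 z != 0.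
  apply: (@line_avoids (fun i => u (e i)) (fun i => v (e i))).
  - by move=> i; apply: torus_neq0; exact: cu.1.
  - by move=> i; apply: torus_neq0; exact: cv.1.
  - by rewrite -tw.
  - by rewrite -tw.
by have [[_ h]|[_ h]] := sub12 z cz; [move/eqP: pz|move/eqP: qz]; apply; exact: h.
Qed.

End Coordinates.
End Dimension.

(** * Krull dimension of a coset *)

Fixpoint multi_index (M m : nat) : finType :=
  if m is m'.+1 then (multi_index M m' * 'I_M)%type : finType else unit.

Lemma card_multi_index M m : #|{: multi_index M m}| = (M ^ m)%N.
Proof.
elim: m => [|m IHm] /=; first by rewrite card_unit.
by rewrite card_prod IHm card_ord expnSr.
Qed.

(** The nested pairs keep the last exponent outermost, so that a relation can be expanded in powers
    of the last function alone. *)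
Fixpoint monomial (T : Type) (A : comNzRingType) (M : nat) (f : nat -> T -> A)
    (m : nat) : multi_index M m -> T -> A :=
  match m return multi_index M m -> T -> A with
  | 0 => fun _ _ => 1
  | m'.+1 => fun a u => monomial f a.1 u * f m' u ^+ a.2
  end.

Section KrullDimension.
Variables (R : realType) (G : zmodType).
Local Notation C := (R[i]).
Implicit Types (t u v : ambient R G) (K : set G).

(** The regular functions vanishing on an irreducible set form a prime ideal. *)
Lemma zariski_irreducible_mul (Z : set (ambient R G)) p q :
  zariski_irreducible Z -> Z `<=` @torus R G ->
  (forall u, Z u -> regular p u * regular q u = 0) ->
  (exists2 u, Z u & regular p u != 0) -> forall u, Z u -> regular q u = 0.
Proof.
move=> [_ irr] ZT pq [u Zu pu].
have [|h|h v /h[] //] := irr _ _ (zero_set_closed p) (zero_set_closed q).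
  move=> v Zv; have /eqP := pq v Zv; rewrite mulf_eq0 => /orP[] /eqP h.
    by left; split=> //; exact: ZT.
  by right; split=> //; exact: ZT.
by move/eqP: pu => []; have [] := h u Zu.
Qed.

Section Coordinates.
Variables (K : set G) (d : nat) (e : 'I_d -> G) (c : G -> 'I_d -> int).
Hypotheses (fgG : fin_generated G) (satK : saturated K) (bK : is_basis K e c).
Variable t : ambient R G.
Hypothesis tT : torus t.
Let sK := satK.1.

(** These subgroups decrease from [G] at 0 to [K] at [d], so their cosets grow from the point [t] to
    the whole coset, by one coordinate at a time. *)
Let flag (i : nat) : set G := [set x | forall j : 'I_d, (j < i)%N -> c x j = 0].

Let flag_saturated i : saturated (flag i).
Proof.
split; first split.
- by move=> j _; rewrite (coord0 sK bK).
- by move=> x y hx hy j ji; rewrite (coordB sK bK) hx // hy // subrr.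
- move=> x k k0 hx j ji; apply/eqP; have /eqP := hx j ji.
  by rewrite (coordMn sK bK) mulrn_eq0 => /orP[/eqP k0'|//]; rewrite k0' in k0.
Qed.

Lemma coset_has_chain : has_chain (coset K t) d.
Proof.
exists (fun i => coset (flag i) t); split=> [i _|i id].
  split.
  - exact: coset_closed.
  - have [d' [e' [c' b']]] := basis_exists (flag_saturated i) fgG.
    exact: coset_irreducible (flag_saturated i) b' _ tT.
  - by apply: coset_sub => x /(coord_eq0P sK bK) c0 j _; exact: c0.
have fS : flag i.+1 `<=` flag i by move=> x h j ji; apply: h; exact: ltnW.
split; first exact: coset_sub.
pose x := e (Ordinal id).
have nx : ~ flag i.+1 x.
  move=> /(_ (Ordinal id) (ltnSn i)); rewrite /x (coord_basis sK bK) eqxx.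
  by move/eqP; rewrite oner_eq0.
have [u cu ux] := coset_separates (flag_saturated i.+1) fgG tT nx.
move=> /(_ u cu)[_ /(_ x)]; move/eqP: ux => ux h; apply: ux; apply: h => j ji.
rewrite /x (coord_basis sK bK); case: eqP => // ij; move: ji.
by rewrite -ij /= ltnn.
Qed.

(** Laurent polynomials whose exponents in the basis are bounded by [N]; the bounds add under
    products, which is all the counting argument uses. *)
Let box N (f : ambient R G -> C) := exists2 p : seq (C * G),
  forall a, a \in p -> forall j, (`|c a.2 j|%N <= N)%N &
  forall u, torus u -> f u = regular p u.

Let box_ext N f g : (forall u, torus u -> f u = g u) -> box N f -> box N g.
Proof. by move=> fg [p pN fp]; exists p => // u uT; rewrite -fg // fp. Qed.

Let box_le N M f : (N <= M)%N -> box N f -> box M f.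
Proof.
by move=> NM [p pN fp]; exists p => // a /pN h j; exact: leq_trans (h j) NM.
Qed.

Let box_cst N z : box N (fun=> z).
Proof.
exists [:: (z, 0)].
  by move=> a; rewrite inE => /eqP -> j /=; rewrite (coord0 sK bK).
by move=> u uT; rewrite regular_cons regular_nil /= torus0 // mulr1 addr0.
Qed.

Let box_add N f g : box N f -> box N g -> box N (fun u => f u + g u).
Proof.
move=> [p pN fp] [q qN gq]; exists (p ++ q).
  by move=> a; rewrite mem_cat => /orP[/pN|/qN].
by move=> u uT; rewrite fp // gq // regular_cat.
Qed.

Let box_mul N M f g : box N f -> box M g -> box (N + M) (fun u => f u * g u).
Proof.
move=> [p pN fp] [q qN gq]; exists (regular_mul p q).
  move=> _ /allpairsP[[a b] [/= ap bq ->]] j /=.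
  rewrite (coordD sK bK); move: (pN _ ap j) (qN _ bq j) => /= h1 h2.
  by move: h1 h2; move: (c a.2 j) (c b.2 j) => x y; lia.
by move=> u uT; rewrite fp // gq // regular_mulE.
Qed.

Let box_sum N (I : Type) (s : seq I) (P : pred I) (f : I -> ambient R G -> C) :
  (forall i, P i -> box N (f i)) -> box N (fun u => \sum_(i <- s | P i) f i u).
Proof.
move=> fN; elim: s => [|i s IHs].
  by apply: box_ext (box_cst N 0) => u _; rewrite big_nil.
have [Pi|nPi] := boolP (P i); last first.
  by apply: box_ext IHs => u _; rewrite big_cons (negbTE nPi).
by apply: box_ext (box_add (fN i Pi) IHs) => u _; rewrite big_cons Pi.
Qed.

Let box_exp N f k : box N f -> box (k * N) (fun u => f u ^+ k).
Proof.
move=> fN; elim: k => [|k IHk]; first exact: box_cst.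
by rewrite mulSn; apply: box_ext (box_mul fN IHk) => u _; rewrite exprS.
Qed.

Let box_exists p : exists N, box N (regular p).
Proof.
exists (\max_(a <- p) \max_j `|c a.2 j|%N)%N; exists p => // a ap j.
apply: leq_trans (_ : (\max_i `|c a.2 i|%N <= _)%N).
  exact: (leq_bigmax j).
exact: (@leq_bigmax_seq _ _ _ (fun a : C * G => \max_i `|c a.2 i|%N)).
Qed.

Let box_monomial B M f e' (a : multi_index M e') :
  (forall i, (i < e')%N -> box B (f i)) -> box (e' * (M * B)) (monomial f a).
Proof.
elim: e' a => [|k IHk] a fB; first exact: box_cst.
rewrite mulSn addnC; apply: box_mul; first by apply: IHk => i /ltnW; exact: fB.
apply: box_le (box_exp a.2 (fB k (ltnSn k))).
by rewrite leq_mul2r ltnW ?orbT.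
Qed.

(* The term of lowest order in the last function, restricted to the previous
   member of the chain, reduces a relation to one with fewer functions. *)
Let monomial_independent B M f (Z : nat -> set (ambient R G)) m
    (z : multi_index M m -> C) :
  (forall i, (i < m)%N -> box B (f i)) ->
  (forall i, (i <= m)%N -> zariski_irreducible (Z i) /\ Z i `<=` @torus R G) ->
  (forall i, (i < m)%N -> [/\ Z i `<=` Z i.+1,
     forall u, Z i u -> f i u = 0 & exists2 u, Z i.+1 u & f i u != 0]) ->
  (forall u, Z m u -> \sum_a z a * monomial f a u = 0) -> forall a, z a = 0.
Proof.
elim: m z => [|m IHm] z fB Zirr Zf z0.
  have [[[u /z0 zu] _] _] := Zirr 0%N isT; case; rewrite -[LHS]mulr1 -[RHS]zu.
  by symmetry; apply: (@big_pred1 _ _ _ unit tt) => -[].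
pose g (j : 'I_M) u := \sum_a z (a, j) * monomial f a u.
have gE u : Z m.+1 u -> \sum_j g j u * f m u ^+ j = 0.
  move=> /z0 zu; rewrite -[RHS]zu (eq_bigr (fun j =>
      \sum_a z (a, j) * (monomial f a u * f m u ^+ j))); last first.
    by move=> j _; rewrite mulr_suml; apply: eq_bigr => a _; rewrite mulrA.
  by rewrite exchange_big pair_big /=; apply: eq_bigr => -[].
have gB j : box (m * (M * B)) (g j).
  apply: box_sum => a _; rewrite -[(m * _)%N]add0n; apply: box_mul.
    exact: box_cst.
  by apply: box_monomial => i im; apply: fB; exact: ltnW.
have [ZS f0 [v Zv fv]] := Zf m (ltnSn m).
suff zj (j : 'I_M) a : z (a, j) = 0 by case=> a j.
move: a; have [k] := ubnP (j : nat); elim: k j => // k IHk j jk.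
apply: IHm => [i im|i im|i im|].
- by apply: fB; exact: ltnW.
- by apply: Zirr; exact: leqW.
- by apply: Zf; exact: ltnW.
(* By induction the terms with last exponent below [j] vanish, so the relation is [f m ^+ j] times
   [h]. As [f m] does not vanish on the irreducible [Z m.+1], [h] does; on [Z m], where [f m] is 0,
   only [g j] is left of it. *)
pose h u := \sum_(i < M | (j <= i)%N) g i u * f m u ^+ (i - j).
have [q _ hq] : box (m * (M * B) + M * B) h.
  apply: box_sum => i _; apply: box_mul; first exact: gB.
  apply: box_le (box_exp _ (fB m (ltnSn m))).
  by rewrite leq_mul2r (leq_trans (leq_subr _ _)) ?orbT // ltnW.
have [p _ fp] := box_exp j (fB m (ltnSn m)).
have [irr ZT] := Zirr m.+1 (leqnn _).
have h0 : forall u, Z m.+1 u -> regular q u = 0.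
  apply: (@zariski_irreducible_mul _ p q) => //.
    move=> u Zu; rewrite -(fp _ (ZT _ Zu)) -(hq _ (ZT _ Zu)) -[RHS](gE u Zu).
    rewrite [RHS](bigID (fun i : 'I_M => (j <= i)%N)) /= [X in _ = _ + X]big1.
      rewrite addr0 mulr_sumr; apply: eq_bigr => i ji.
      by rewrite mulrCA -exprD subnKC.
    move=> i; rewrite -ltnNge => ij; rewrite /g big1 ?mul0r // => a _.
    by rewrite (IHk i) ?mul0r // (leq_trans ij).
  by exists v => //; rewrite -(fp _ (ZT _ Zv)) expf_neq0.
move=> u Zu; have := h0 u (ZS u Zu); rewrite -(hq _ (ZT _ (ZS _ Zu))).
rewrite /h (bigD1 j) //= subnn mulr1 big1 ?addr0 // => i /andP[ji ij].
by rewrite f0 // expr0n subn_eq0 leqNgt ltn_neqAle ji eq_sym ij mulr0.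
Qed.

(** On the coset such a function lies in the span of finitely many monomials; the exponents from -N
    to N are shifted by [N] to index them. *)
Let box_expand N f : box N f ->
  exists coef : {ffun 'I_d -> 'I_(N + N).+1} -> C, forall u, coset K t u ->
    f u = \sum_b coef b * \prod_j (u (e j) / t (e j)) ^ ((b j : nat)%:Z - N%:Z).
Proof.
move=> [p pN fp].
pose idx g : {ffun 'I_d -> 'I_(N + N).+1} := [ffun j => inord `|(c g j + N%:Z)%R|%N].
exists (fun b => \sum_(a <- p) (if b == idx a.2 then a.1 * t a.2 else 0)).
move=> u cu; rewrite (fp _ cu.1) (eq_bigr _ (fun b _ => mulr_suml _ _ _ _)).
rewrite exchange_big /= /regular big_seq [RHS]big_seq; apply: eq_bigr => a ap.
rewrite (bigD1 (idx a.2)) //= eqxx [X in _ + X]big1 ?addr0; last first.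
  by move=> b /negbTE ->; rewrite mul0r.
rewrite (coset_expand bK a.2 tT cu) mulrA; congr (_ * _).
apply: eq_bigr => j _; congr (_ ^ _); rewrite ffunE inordK.
  by have := pN _ ap j; move: (c a.2 j) => x; lia.
by have := pN _ ap j; move: (c a.2 j) => x; lia.
Qed.

(** For each step of the chain a function is chosen that vanishes on [Z i] but not on [Z i.+1]. If
    [m] exceeded [d], the bounded monomials in these functions would outnumber the Laurent monomials
    available on the coset, against their independence. *)
Lemma coset_chain_bound m : has_chain (coset K t) m -> (m <= d)%N.
Proof.
move=> [Z [Zc Zlt]]; rewrite leqNgt; apply/negP => dm.
have ZT i : (i <= m)%N -> Z i `<=` @torus R G.
  by move=> im u; have [_ _ h] := Zc i im; move/h => -[].
have /choice[p pP] : forall i, exists p, (i < m)%N ->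
    (forall u, Z i u -> regular p u = 0) /\
    (exists2 u, Z i.+1 u & regular p u != 0).
  move=> i; have [im|] := ltnP i m; last by exists [::].
  have [_ /existsNP[u /not_implyP[Zu nZu]]] := Zlt i im.
  have [[F ZF] _ _] := Zc i (ltnW im).
  have [p Fp pu] : exists2 p, F p & regular p u != 0.
    apply: contrapT => np; apply: nZu; rewrite ZF; split; first exact: ZT Zu.
    by move=> p Fp; apply/eqP/negPn/negP => pu; apply: np; exists p.
  exists p => _; split; last by exists u.
  by move=> v; rewrite ZF => -[_]; apply.
have [N NP] := choice (fun i => box_exists (p i)).
pose B := (\max_(i < m) N i)%N; pose f i := regular (p i).
have fB i : (i < m)%N -> box B (f i).
  move=> im; apply: box_le (NP i).
  exact: (leq_bigmax_cond (F := fun i : 'I_m => N i) (Ordinal im)).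
(* The monomials have exponents bounded by [L], and 2L + 1 is at most D M. Since M exceeds D^d, the
   dimension is at most D^d M^d < M^(d+1), which is at most M^m. *)
pose D := ((m * B).*2.+1)%N; pose M := (D ^ d).+1.
pose L := (m * (M * B))%N.
have ltM : (#|{ffun 'I_d -> 'I_(L + L).+1}| < #|{: multi_index M m}|)%N.
  rewrite card_multi_index card_ffun !card_ord.
  apply: (@leq_ltn_trans ((D * M) ^ d)%N).
    have leX x y k : (x <= y -> x ^ k <= y ^ k)%N.
      by case: k => // k xy; rewrite leq_exp2r.
    apply: leX; rewrite /D mulSn -muln2 mulnAC muln2 -mulnA [(B * M)%N]mulnC.
    by rewrite -/L -addnn -[leqLHS]add1n leq_add2r.
  apply: (@leq_trans (M ^ d.+1)%N); last by rewrite leq_pexp2l.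
  by rewrite expnMn expnS ltn_pmul2r ?expn_gt0.
have [coef coefP] := choice (fun a : multi_index M m =>
  box_expand (box_monomial a fB)).
have [z [a za] z0] := linear_relation coef ltM.
move/eqP: za; apply; apply: (monomial_independent (Z := Z) fB) => [i im|i im|u Zu].
- by split; [have [] := Zc i im|exact: ZT].
- have [p0 p1] := pP i im; split=> //; exact: properW (Zlt i im).
have cu : coset K t u by have [_ _] := Zc m (leqnn m); exact.
rewrite (eq_bigr _ (fun a _ => congr1 (GRing.mul (z a)) (coefP a u cu))).
rewrite (eq_bigr _ (fun a _ => mulr_sumr _ _ _ _)) exchange_big big1 // => b _ /=.
rewrite (eq_bigr _ (fun a _ => mulrA _ _ _)) -mulr_suml.
by rewrite [X in X * _]z0 mul0r.
Qed.

Lemma dim_coset : Defs.dim (coset K t) = d.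
Proof.
rewrite /Defs.dim; apply: xget_unique => [|m [hm mmax]].
  by split; [exact: coset_has_chain|exact: coset_chain_bound].
apply/eqP; rewrite eqn_leq coset_chain_bound //.
by rewrite mmax //; exact: coset_has_chain.
Qed.

End Coordinates.
End KrullDimension.

(** * Polynomials with alternating partial sums *)

Section AlternatingPartialSums.
Implicit Types (p q : {poly int}) (r k : nat).

(* With [a_k] the coefficient of [X^(r - k)], the partial sums of the [a_k]
   alternate in sign; differences of consecutive ones then show that the [a_k]
   themselves alternate. *)
Definition alternating_sums r p := (size p <= r.+1)%N /\
  forall k, (k <= r)%N -> 0 <= (-1) ^+ k * \sum_(i < k.+1) p`_(r - i).

Lemma alternating_sums0 r : alternating_sums r 0.
Proof.
split; first by rewrite size_poly0.
by move=> k _; rewrite big1 ?mulr0 // => i _; rewrite coef0.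
Qed.

Lemma alternating_sumsD r p q :
  alternating_sums r p -> alternating_sums r q -> alternating_sums r (p + q).
Proof.
move=> [sp hp] [sq hq]; split.
  by apply: leq_trans (size_polyD _ _) _; rewrite geq_max sp.
move=> k kr; rewrite (eq_bigr (fun i : 'I_k.+1 => p`_(r - i) + q`_(r - i))).
  by rewrite big_split mulrDr addr_ge0 ?hp ?hq.
by move=> i _; rewrite coefD.
Qed.

(** Seen in degree [r.+1], the leading coefficient is 0 and each partial sum moves one place on; the
    negation repairs the sign. This is the form in which contraction enters. *)
Lemma alternating_sums_shift r p :
  alternating_sums r p -> alternating_sums r.+1 (- p).
Proof.
move=> [sp hp]; split; first by rewrite size_polyN leqW.
move=> k kr; rewrite big_ord_recl subn0 coefN nth_default ?oppr0 ?add0r //.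
case: k kr => [|k] kr; first by rewrite big_ord0 mulr0.
rewrite (eq_bigr (fun i : 'I_k.+1 => - p`_(r - i))); last first.
  by move=> i _; rewrite coefN lift0 subSS.
by rewrite sumrN exprS mulN1r mulrNN hp.
Qed.

Let coef_XB1M q i : (('X - 1) * q)`_i.+1 = q`_i - q`_i.+1.
Proof. by rewrite mulrBl mul1r coefB coefXM. Qed.

Let sign_coef_XB1_exp j i : 0 <= (-1) ^+ (j + i) * (('X - 1) ^+ j : {poly int})`_i.
Proof.
elim: j i => [|j IHj] i.
  by rewrite expr0 coef1; case: i => [|i]; rewrite ?mulr0 // expr0 mulr1.
rewrite exprS; case: i => [|i].
  rewrite mulrBl mul1r coefB coefXM eqxx sub0r addn0 exprS mulN1r mulrNN.
  by have := IHj 0%N; rewrite addn0.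
rewrite coef_XB1M mulrBr addr_ge0 //.
  by rewrite addSnnS -addSnnS addSn addnS !exprS !mulN1r opprK.
by rewrite -mulNr addSn exprS mulN1r opprK.
Qed.

Let sum_coef_XB1M r q k : (size q <= r)%N -> (k < r)%N ->
  \sum_(i < k.+1) (('X - 1) * q)`_(r - i) = q`_(r - k.+1).
Proof.
move=> sq; elim: k => [|k IHk] kr.
  rewrite big_ord1 subn0 -{1}(prednK kr) coef_XB1M (prednK kr).
  by rewrite [q`_r]nth_default // subr0 subn1.
rewrite big_ord_recr /= IHk ?(ltnW kr) //.
have -> : (r - k.+1 = (r - k.+2).+1)%N by lia.
by rewrite coef_XB1M addrC subrK.
Qed.

(** For positive j the partial sums are coefficients of the next lower power, with binomial signs,
    except that the full sum is the value at 1, which is 0. For j = 0 only the full sum is nonzero,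
    and its two signs cancel. *)
Lemma alternating_sums_XB1_exp r j : (j <= r)%N ->
  alternating_sums r ((-1) ^+ (r - j) *: ('X - 1) ^+ j).
Proof.
move=> jr; split.
  apply: leq_trans (size_scale_leq _ _) _.
  by rewrite -[1]/(1%:P) size_exp_XsubC.
move=> k kr.
rewrite (eq_bigr (fun i : 'I_k.+1 => (-1) ^+ (r - j) * (('X - 1) ^+ j : {poly int})`_(r - i))).
  2: by move=> i _; rewrite coefZ.
rewrite -mulr_sumr mulrA -exprD.
case: j jr => [|j] jr.
  rewrite subn0 expr0.
  have [kr'|] := ltnP k r.
    rewrite big1 ?mulr0 // => i _; rewrite coef1.
    by have := ltn_ord i; case: eqP => //; lia.
  move=> rk; have {rk kr}-> : k = r by apply/eqP; rewrite eqn_leq kr.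
  rewrite big_ord_recr /= subnn coef1 big1 ?add0r ?mulr1; last first.
    by move=> i _; rewrite coef1; have := ltn_ord i; case: eqP => //; lia.
  by rewrite addnn -muln2 mulnC exprM sqrrN !expr1n.
rewrite exprS; have sj : (size (('X - 1 : {poly int}) ^+ j) <= r)%N.
  by rewrite -[1]/(1%:P) size_exp_XsubC.
have [kr'|rk] := ltnP k r.
  rewrite sum_coef_XB1M //.
  suff -> : (-1) ^+ (k + (r - j.+1)) = (-1) ^+ (j + (r - k.+1)) :> int.
    exact: sign_coef_XB1_exp.
  rewrite -signr_odd -[RHS]signr_odd; congr (_ ^+ _); congr nat_of_bool; lia.
have {rk kr}-> : k = r by apply/eqP; rewrite eqn_leq kr.
case: r jr sj => // r jr sj.
rewrite big_ord_recr /= sum_coef_XB1M // subnn.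
by rewrite mulrBl mul1r coefB coefXM eqxx sub0r subrr mulr0.
Qed.

Lemma alternating_sumsP r p : alternating_sums r p ->
  exists a : nat -> int, p = \sum_(i < r.+1) a i *: 'X^(r - i) /\
    forall k : nat, (k <= r)%N ->
      0 <= (-1) ^+ k * a k /\ 0 <= (-1) ^+ k * \sum_(i < k.+1) a i.
Proof.
move=> [sp hp]; exists (fun i => p`_(r - i)); split.
  rewrite -{1}(coefK p) poly_def (big_ord_widen _ (fun i => p`_i *: 'X^i) sp).
  rewrite big_mkcond (reindex_inj rev_ord_inj); apply: eq_bigr => i _ /=.
  rewrite subSS; case: ifP => // /negbT; rewrite -leqNgt => h.
  by rewrite nth_default // scale0r.
move=> k kr; split; last exact: hp.
case: k kr => [|k] kr; first by have := hp 0%N kr; rewrite big_ord1.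
have := hp k.+1 kr; have := hp k (ltnW kr).
rewrite [X in _ -> 0 <= _ * X -> _]big_ord_recr /= => h1; rewrite mulrDr => h2.
by have := addr_ge0 h1 h2; rewrite exprS mulN1r !mulNr addNKr.
Qed.

End AlternatingPartialSums.

(** * Rearrangement of finite sums *)

Section FiniteSums.

Lemma fsbig_bigcup_disjoint (I J : choiceType) (V : nmodType) (D : set I)
    (B : I -> set J) (F : J -> V) :
  finite_set D -> (forall i, D i -> finite_set (B i)) ->
  (forall i j x, D i -> D j -> B i x -> B j x -> i = j) ->
  \sum_(x \in \bigcup_(i in D) B i) F x = \sum_(i \in D) \sum_(x \in B i) F x.
Proof.
move=> finD finB disj; set U := \bigcup_(i in D) B i.
have finU : finite_set U by exact: bigcup_finite.
pose H x i := if `[< B i x >] then F x else 0.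
transitivity (\sum_(x \in U) \sum_(i \in D) H x i).
  apply: eq_fsbigr => x /set_mem [i Di Bix].
  rewrite (fsbigD1 i) //= {1}/H asboolT // fsbig1 ?addr0 // => j [Dj /= ji].
  by rewrite /H asboolF // => Bjx; apply: ji; exact: disj Bjx Bix.
rewrite exchange_fsbig //; apply: eq_fsbigr => i /set_mem Di.
rewrite -(@fsbig_widen _ _ _ _ (B i) U (H^~ i)).
- by apply: eq_fsbigr => x /set_mem Bix; rewrite /H asboolT.
- by move=> x Bix; exists i.
- by move=> x [_ nBix] /=; rewrite /H asboolF.
Qed.

Lemma big_subset_setU1 (T : finType) (V : nmodType) (i : T) (S : {set T})
    (F : {set T} -> V) : i \notin S ->
  \sum_(A : {set T} | A \subset (i |: S)%SET) F A =
  \sum_(A : {set T} | A \subset S) F A +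
  \sum_(A : {set T} | A \subset S) F (i |: A)%SET.
Proof.
move=> iS; rewrite (bigID (fun A : {set T} => i \notin A)) /=; congr (_ + _).
  apply: eq_bigl => A; apply/andP/idP => [[AS iA]|AS].
    by rewrite -(finset.setU1K iS) finset.subsetD1 AS.
  split; first exact: fintype.subset_trans AS (finset.subsetUr _ _).
  by apply: contra iS; exact: (fintype.subsetP AS).
rewrite (reindex_onto (fun A => (i |: A)%SET) (fun A => (A :\ i)%SET)) /=.
  apply: eq_bigl => A; rewrite negbK finset.setU11 andbT.
  apply/andP/idP => [[AS /eqP <-]|AS].
    apply/fintype.subsetP => x; rewrite !inE => /andP[xi /orP[/eqP xi'|xA]].
      by rewrite xi' eqxx in xi.
    have := fintype.subsetP AS x; rewrite !inE xA orbT => /(_ isT).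
    by rewrite (negbTE xi).
  split; first exact: finset.setUS.
  by rewrite finset.setU1K //; apply: contra iS; exact: (fintype.subsetP AS).
by move=> A /andP[_]; rewrite negbK => iA; rewrite finset.setD1K.
Qed.

End FiniteSums.

(** * Components inside a coset and adjunction of one element *)

Section LayerSets.
Variables (R : realType) (G : zmodType) (n : nat) (lam : 'I_n -> G).
Hypothesis fgG : fin_generated G.
Local Notation C := (R[i]).
Implicit Types (t u v : ambient R G) (K : set G) (A B S : {set 'I_n}).
Implicit Types (X D : set (ambient R G)).

Definition has_basis K d := exists (e : 'I_d -> G) c, is_basis K e c.

Lemma torus1 : torus ((fun=> 1) : ambient R G).
Proof. by split=> [g|g h]; rewrite ?oner_eq0 ?mulr1. Qed.

Lemma has_basis_dim K d t : saturated K -> torus t -> has_basis K d ->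
  Defs.dim (coset K t) = d.
Proof. by move=> satK tT [e [c bK]]; exact: dim_coset bK _ tT. Qed.

(** Both lengths are the Krull dimension of the coset of the trivial character. *)
Lemma has_basis_uniq K d d' : saturated K -> has_basis K d -> has_basis K d' ->
  d = d'.
Proof.
move=> satK h h'.
by rewrite -(has_basis_dim satK torus1 h) (has_basis_dim satK torus1 h').
Qed.

(* For saturated [K] and a coset [X] of it, these are the connected components
   of the intersection of [X] with the hypersurfaces indexed by [A]. *)
Definition comps K X A : set (set (ambient R G)) :=
  [set D | exists2 u, X u /\ (forall i, i \in A -> u (lam i) = 1)
         & D = coset (cl lam K A) u].

Lemma comps_sub K t A D : torus t -> comps K (coset K t) A D ->
  D `<=` coset K t.
Proof.
move=> tT [u [Xu uA] ->]; rewrite -(coset_eq Xu).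
by apply: coset_sub; exact: sub_cl.
Qed.

(** Intersections may be taken in two stages, passing to components in between: the closures compose
    by [cl_cl], and elements of [A] keep the value 1 on a component over [A]. *)
Lemma comps_setU K t A B : saturated K -> torus t ->
  comps K (coset K t) (A :|: B)%SET =
  \bigcup_(D in comps K (coset K t) A) comps (cl lam K A) D B.
Proof.
move=> satK tT; have sK := satK.1; apply/seteqP; split.
  move=> _ [u [Xu uAB] ->]; exists (coset (cl lam K A) u).
    by exists u => //; split=> // i iA; apply: uAB; rewrite inE iA.
  exists u; last by rewrite cl_cl.
  split; first by apply: coset_refl; exact: Xu.1.
  by move=> i iB; apply: uAB; rewrite inE iB orbT.
move=> _ [_ [v [Xv vA] ->]] [u [vu uB] ->]; exists u; last by rewrite cl_cl.
split.
  by have /(comps_sub tT)/(_ u vu) : comps K (coset K t) A (coset (cl lam K A) v)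
    by exists v.
move=> i; rewrite inE => /orP[iA|]; last exact: uB.
by rewrite vu.2 ?vA //; exact: mem_cl.
Qed.

Lemma comps_disjoint K t A B D D' E : torus t ->
  comps K (coset K t) A D -> comps K (coset K t) A D' ->
  comps (cl lam K A) D B E -> comps (cl lam K A) D' B E -> D = D'.
Proof.
move=> tT [u [Xu _] ->] [v [Xv _] ->] [w [uw _] ->] [w' [vw' _]] ww'.
have : coset (cl lam (cl lam K A) B) w' w by rewrite -ww'; split=> //; exact: uw.1.
move/(coset_sub (@sub_cl _ _ _ _ _)); rewrite (coset_eq vw') => vw.
by rewrite -(coset_eq uw) (coset_eq vw).
Qed.

(** [K'] is generated by [K] and [kappa], so expanding modulo [K'] leaves a multiple of [kappa],
    which becomes the new coordinate; saturation excludes a relation on [kappa] alone. *)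
Lemma is_basis_cons K kappa d (e : 'I_d -> G) c K' : saturated K ->
  ~ K kappa -> (forall x, K' x <-> exists a, K (x - kappa *~ a)) ->
  is_basis K' e c -> exists c',
  is_basis K (fun i : 'I_d.+1 => if unlift ord0 i is Some j then e j else kappa) c'.
Proof.
move=> satK nk K'E [b1 b2]; have sK := satK.1.
have [a Ka] := choice (fun x => (K'E _).1 (b1 x)).
exists (fun x i => if unlift ord0 i is Some j then c x j else a x); split.
  move=> x; rewrite big_ord_recl unlift_none /=.
  rewrite (eq_bigr (fun j => e j *~ c x j)).
    by rewrite opprD addrA addrAC; exact: Ka.
  by move=> j _; rewrite liftK.
move=> c'; rewrite big_ord_recl unlift_none /=.
rewrite (eq_bigr (fun j => e j *~ c' (lift ord0 j))); last first.
  by move=> j _; rewrite liftK.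
move=> Kc'; have c'0 j : c' (lift ord0 j) = 0.
  apply: (b2 (fun j => c' (lift ord0 j))); apply/K'E; exists (- c' ord0).
  by rewrite mulrNz opprK addrC.
move=> i; case: (unliftP ord0 i) => [j ->//|->].
move: Kc'; rewrite big1 ?addr0 => [|j _]; last by rewrite c'0 mulr0z.
move=> Kk; apply/eqP/negPn/negP => c0; apply: nk.
exact: saturatedMz satK c0 Kk.
Qed.

Section Step.
Variables (K : set G) (i : 'I_n).
Hypotheses (satK : saturated K) (nKi : ~ K (lam i)).
Let sK := satK.1.

(** The closure over [i] is [K] enlarged by one primitive element [kappa], and [p] will be the
    number of components of the hypersurface in a coset of [K]. *)
Lemma primitive_step : exists kappa p, [/\ (0 < p)%N,
  K (lam i - kappa *+ p), ~ K kappa &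
  forall x, cl lam K [set i]%SET x <-> exists a, K (x - kappa *~ a)].
Proof.
have [kappa [p [p0 Kp KP]]] := primitive_root satK fgG nKi.
exists kappa, p; split=> //.
  move=> Kk; apply: nKi; apply/(subgroup_congr sK Kp); exact: subgroupMn.
move=> x; split; first by move/cl_set1P; exact: KP.
move=> [a Ka]; apply/cl_set1P; exists p => //; exists a.
have -> : x *+ p - lam i *~ a = (x - kappa *~ a) *+ p - (lam i - kappa *+ p) *~ a.
  rewrite mulrnBl mulrzBl opprB addrA; congr (_ - _).
  by rewrite [X in _ - X + _]pmulrn [kappa *+ p]pmulrn -!mulrzA mulrC subrK.
by apply: subgroupB => //; [exact: subgroupMn|exact: subgroupMz].
Qed.

Lemma has_basis_step d : has_basis K d ->
  exists2 d', d = d'.+1 & has_basis (cl lam K [set i]%SET) d'.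
Proof.
move=> hd; have [kappa [p [p0 Kp nk K'E]]] := primitive_step.
have satK' := cl_saturated lam [set i]%SET sK.
have [d' [e' [c' b']]] := basis_exists satK' fgG.
exists d'; last by exists e', c'.
have [c bK] := is_basis_cons satK nk K'E b'.
by apply: (has_basis_uniq satK hd); eexists; exists c; exact: bK.
Qed.

End Step.
End LayerSets.

(** * Enumeration of the roots of a nonzero number *)

Section RootCount.
Variable F : numClosedFieldType.

Lemma roots_of_unity_enum p : (0 < p)%N ->
  exists r : seq F, [/\ uniq r, size r = p & forall z, (z \in r) = (z ^+ p == 1)].
Proof.
move=> p0; have [r pr] := closed_field_poly_normal ('X^p - 1 : {poly F}).
have lc : lead_coef ('X^p - 1 : {poly F}) = 1 by apply/eqP; exact: monicXnsubC.
rewrite lc scale1r in pr; exists r; split.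
- rewrite -separable_prod_XsubC -pr; apply: separable_Xn_sub_1.
  by rewrite pnatr_eq0 -lt0n.
- have := size_prod_XsubC r id; rewrite -pr size_XnsubC // => -[]; exact: esym.
- by move=> z; rewrite -root_prod_XsubC -pr rootE !hornerE subr_eq0.
Qed.

Lemma roots_enum p (a : F) : (0 < p)%N -> a != 0 ->
  exists r : seq F, [/\ uniq r, size r = p & forall z, (z \in r) = (z ^+ p == a)].
Proof.
move=> p0 a0; have [r [ur sr rE]] := roots_of_unity_enum p0.
have b0 : p.-root a != 0 by rewrite rootC_eq0.
exists [seq p.-root a * z | z <- r]; split.
- by rewrite map_inj_uniq //; exact: mulfI.
- by rewrite size_map.
- move=> z; rewrite -[z in LHS](mulVKf b0) mem_map; last exact: mulfI.
  by rewrite rE exprMn exprVn rootCK // mulrC -(inj_eq (mulIf a0)) divfK // mul1r.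
Qed.

End RootCount.

(** * Finiteness and number of the components *)

Section CountComponents.
Variables (R : realType) (G : zmodType) (n : nat) (lam : 'I_n -> G).
Hypothesis fgG : fin_generated G.
Local Notation C := (R[i]).
Implicit Types (t u v : ambient R G) (K : set G) (A B S : {set 'I_n}).
Implicit Types (X D : set (ambient R G)).
Local Notation comps := (comps lam).

(** On the coset, [lam i] differs from [kappa *+ p] by an element with a fixed value, so
    [u (lam i) = 1] says that [u kappa] is a p-th root of the constant [a]. The components are the
    fibres over these roots. *)
Lemma comps_bij K i t kappa p : saturated K -> torus t -> (0 < p)%N ->
  ~ K kappa -> K (lam i - kappa *+ p) ->
  (forall x, cl lam K [set i]%SET x <-> exists a, K (x - kappa *~ a)) ->
  exists r : seq C, [/\ uniq r, size r = p &
    set_bij [set` r] (comps K (coset K t) [set i]%SET)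
      (fun z => [set u | coset K t u /\ u kappa = z])].
Proof.
move=> satK tT p0 nk Kp K'E; have sK := satK.1.
pose a := (t (lam i - kappa *+ p))^-1.
have a0 : a != 0 by rewrite invr_eq0 torus_neq0.
have [r [ur sr rE]] := roots_enum p0 a0; exists r; split=> //.
have satK' := cl_saturated lam [set i]%SET sK.
have kE u : coset K t u -> (u (lam i) = 1) <-> (u kappa ^+ p = a).
  move=> [uT ut]; have : u (lam i - kappa *+ p) = a^-1 by rewrite ut // invrK.
  rewrite torusB // torusMn // => h; split=> h'.
    by apply: invr_inj; rewrite -h h' mul1r.
  by move: h; rewrite h' => h; rewrite -[LHS](divfK a0) h mulVf.
have cE u : coset K t u ->
    coset (cl lam K [set i]%SET) u = [set v | coset K t v /\ v kappa = u kappa].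
  move=> cu; apply/seteqP; split=> v.
    move=> [vT vu]; split.
      by rewrite -(coset_eq cu); split=> // x Kx; apply: vu; exact: sub_cl.
    by apply: vu; apply/K'E; exists 1; rewrite mulr1z subrr; exact: sK.1.
  move=> [[vT vt] vk]; split=> // x /K'E[b Kb].
  have xE (w : ambient R G) : torus w -> w x = w (x - kappa *~ b) * w kappa ^ b.
    by move=> wT; rewrite -torusMz // -torusD // subrK.
  by rewrite (xE v vT) (xE u cu.1) (vt _ Kb) (cu.2 _ Kb) vk.
have ne z : z \in r -> exists2 u, coset K t u & u kappa = z.
  rewrite rE => /eqP za; have z0 : z != 0.
    by apply: contraNneq a0 => z0; rewrite -za z0 expr0n eqn0Ngt p0.
  have [d' [e' [c' b']]] := basis_exists satK' fgG.
  have [c bK] := is_basis_cons satK nk K'E b'.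
  set e := (fun i0 => _) in bK.
  (* Only the first coordinate, at [kappa], matters; the others are set to [z] merely to be
     nonzero. *)
  exists (twist e c t (fun=> z)); first exact: coset_twist.
  have ke : e ord0 = kappa by rewrite /e unlift_none.
  by rewrite -[X in _ X = _]ke; exact: (twist_basis sK bK _ _ tT).
split.
- move=> z /= zr; have [u cu uk] := ne z zr.
  exists u; last by rewrite cE // uk.
  split=> // j; rewrite inE => /eqP ->; apply/kE => //; rewrite uk.
  by apply/eqP; rewrite -rE.
- move=> z z' /set_mem /= zr _ zz'; have [u cu uk] := ne z zr.
  have : [set u | coset K t u /\ u kappa = z'] u by rewrite -zz'.
  by case=> _ <-.
- move=> _ [u [cu uA] ->]; exists (u kappa); last by rewrite cE.
  by rewrite /= rE; apply/eqP/kE => //; apply: uA; rewrite inE.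
Qed.

Lemma comps_mem K i t : saturated K -> K (lam i) ->
  comps K (coset K t) [set i]%SET `<=` [set coset K t].
Proof.
move=> satK Ki _ [u [cu _] ->]; rewrite /= -(coset_eq cu) cl_mem // => j.
by rewrite inE => /eqP ->.
Qed.

Lemma comps_set0 K t : saturated K -> torus t ->
  comps K (coset K t) finset.set0 = [set coset K t].
Proof.
move=> satK tT; apply/seteqP; split=> [_ [u [cu _] ->]|_ ->].
  by rewrite cl_set0 //= (coset_eq cu).
by exists t; [split=> // i; rewrite inE|rewrite cl_set0].
Qed.



Lemma finite_comps K t A : saturated K -> torus t ->
  finite_set (comps K (coset K t) A).
Proof.
have [m] := ubnP #|A|; elim: m K t A => // m IHm K t A Am satK tT.
have [->|/finset.set0Pn[i iA]] := eqVneq A finset.set0.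
  by rewrite comps_set0 //; exact: finite_set1.
rewrite -(finset.setD1K iA) comps_setU //; apply: bigcup_finite.
  have [Ki|nKi] := pselect (K (lam i)).
    exact: sub_finite_set (comps_mem satK Ki) (finite_set1 _).
  have [kappa [p [p0 Kp nk KE]]] := primitive_step fgG satK nKi.
  have [r [_ _ [_ _ surj]]] := comps_bij satK tT p0 nk Kp KE.
  exact: sub_finite_set surj (finite_image _ (finite_seq r)).
move=> _ [u [cu _] ->]; apply: IHm; last exact: cu.1.
  by move: Am; rewrite (finset.cardsD1 i) iA.
exact: cl_saturated satK.1.
Qed.

Lemma comps_sum1 K i t kappa p : saturated K -> torus t -> (0 < p)%N ->
  ~ K kappa -> K (lam i - kappa *+ p) ->
  (forall x, cl lam K [set i]%SET x <-> exists a, K (x - kappa *~ a)) ->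
  \sum_(D \in comps K (coset K t) [set i]%SET) (1 : int) = p%:Z.
Proof.
move=> satK tT p0 nk Kp K'E.
have [r [ur <- bij]] := comps_bij satK tT p0 nk Kp K'E.
rewrite (reindex_fsbig _ _ _ _ bij) -fsbig_seq // big_const_seq count_predT.
by rewrite iter_addr_0 natz.
Qed.

Lemma comps_sum_setU (V : nmodType) (F : set (ambient R G) -> V) K t A B :
  saturated K -> torus t ->
  \sum_(D \in comps K (coset K t) (A :|: B)%SET) F D =
  \sum_(D \in comps K (coset K t) A) \sum_(E \in comps (cl lam K A) D B) F E.
Proof.
move=> satK tT; rewrite comps_setU // fsbig_bigcup_disjoint //.
- exact: finite_comps.
- move=> _ [u [cu _] ->]; apply: finite_comps; last exact: cu.1.
  exact: cl_saturated satK.1.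
- by move=> D D' E DA D'A DB; exact: (comps_disjoint tT DA D'A DB).
Qed.

End CountComponents.

(** * Representatives of the closure modulo the span *)

Section Transversals.
Variables (R : realType) (G : zmodType) (n : nat) (lam : 'I_n -> G).
Hypothesis fgG : fin_generated G.
Implicit Types (t u v : ambient R G) (K : set G) (A B S : {set 'I_n}).
Local Notation comps := (comps lam).
Local Notation cl := (cl lam).
Local Notation span_mod := (span_mod lam).

Lemma span_setU1 K A i x : i \notin A ->
  span_mod K (i |: A)%SET x <-> exists b : int, span_mod K A (x - lam i *~ b).
Proof.
move=> iA; split=> [[c Kc]|[b [c Kc]]].
  exists (c i), c; move: Kc; rewrite (bigD1 i) ?finset.setU11 //= opprD addrA.
  rewrite (eq_bigl (mem A)) // => j; rewrite !inE.
  by have [->|] := eqVneq j i; rewrite ?andbT // andbF (negbTE iA).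
exists (fun j => if j == i then b else c j).
rewrite (bigD1 i) ?finset.setU11 //= eqxx opprD addrA.
rewrite (eq_big (mem A) (fun j => lam j *~ c j)) // => j.
  rewrite !inE.
  by have [->|] := eqVneq j i; rewrite ?andbT // andbF (negbTE iA).
by move=> /andP[_ /negbTE ->].
Qed.

(** Representatives of the quotient of [cl K A] by [span_mod K A], which for independent [A] is the
    finite group that counts the components. *)
Definition transversal K A (T : seq G) :=
  [/\ uniq T, forall g, g \in T -> cl K A g,
      forall x, cl K A x -> exists2 g, g \in T & span_mod K A (x - g) &
      forall g h, g \in T -> h \in T -> span_mod K A (g - h) -> g = h].

Definition independent K S :=
  forall i, i \in S -> ~ cl K (S :\ i)%SET (lam i).

Lemma independent_notin K S A i : subgroup K -> independent K S ->
  i \in S -> i \notin A -> A \subset S -> ~ cl K A (lam i).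
Proof.
move=> sK indS iS iA AS /(cl_sub sK (@sub_cl _ _ _ _ _)) h; apply: (indS i iS).
by apply: h; rewrite finset.subsetD1 AS.
Qed.

Lemma transversal_set0 K : saturated K -> transversal K finset.set0 [:: 0].
Proof.
move=> satK; rewrite /transversal cl_set0 //; split=> //.
- by move=> g; rewrite inE => /eqP ->; exact: satK.1.1.
- by move=> x Kx; exists 0; rewrite ?inE // subr0; exact: sub_span.
- by move=> g h; rewrite !inE => /eqP -> /eqP ->.
Qed.

(** Modulo [cl K B], the new closure is generated by [kappa] and the new span by [kappa *+ p].
    Division by [p] of the coefficient of [kappa] leaves a remainder below [p], and the quotient is
    absorbed by [lam i]. *)
Lemma transversal_step K B i T kappa p : subgroup K -> i \notin B ->
  ~ cl K B (lam i) ->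
  (0 < p)%N -> ~ cl K B kappa -> cl K B (lam i - kappa *+ p) ->
  (forall x, cl (cl K B) [set i]%SET x <-> exists a, cl K B (x - kappa *~ a)) ->
  transversal K B T ->
  transversal K (B :|: [set i])%SET [seq g + kappa *+ j | g <- T, j <- iota 0 p].
Proof.
move=> sK iB nBi p0 nk Kp clE [uT TB covT sepT].
have satB := cl_saturated lam B sK; have sB := satB.1.
have kappa_mult (a : int) : cl K B (kappa *~ a) -> a = 0.
  move=> Ka; apply/eqP/negPn/negP => a0; apply: nk; exact: saturatedMz satB a0 Ka.
have sep g h (j k : nat) (b : int) : g \in T -> h \in T -> (j < p)%N -> (k < p)%N ->
    span_mod K B (g + kappa *+ j - (h + kappa *+ k) - lam i *~ b) ->
    j = k /\ g = h.
  move=> gT hT jp kp hs.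
  (* This is the coefficient of [kappa] modulo [cl K B]. As [j] and [k] are below [p], it can vanish
     only with [b = 0] and [j = k]. *)
  have jk : j%:Z - k%:Z - p%:Z * b = 0.
    apply: kappa_mult.
    have -> : kappa *~ (j%:Z - k%:Z - p%:Z * b) =
        (g + kappa *+ j - (h + kappa *+ k) - lam i *~ b) - g + h +
        (lam i - kappa *+ p) *~ b.
      rewrite !mulrzBr mulrzA mulrzBl -!pmulrn.
      rewrite [_ - _ *~ b - g]addrAC [_ - _ *~ b + h]addrAC subrKA.
      rewrite opprD addrA [g + _]addrC [_ + g - h]addrAC [_ + g - _]addrAC addrK.
      by rewrite [_ - h - _]addrAC subrK.
    apply: subgroupD => //; last exact: subgroupMz.
    apply: subgroupD => //; last exact: TB.
    by apply: subgroupB => //; [exact: span_cl|exact: TB].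
  have b0 : b = 0 by nia.
  have {}jk : j = k by move: jk; rewrite b0; lia.
  split=> //; apply: sepT => //; move: hs.
  by rewrite b0 mulr0z subr0 jk opprD addrACA subrr addr0.
rewrite /transversal -cl_cl //; split.
- apply: allpairs_uniq; [exact: uT|exact: iota_uniq|].
  move=> _ _ /allpairsP[[g j] /= [gT + ->]] /allpairsP[[h k] /= [hT + ->]] /=.
  rewrite !mem_iota !add0n => jp kp gh.
  have [-> ->//] : j = k /\ g = h.
  apply: (sep _ _ _ _ 0) => //; rewrite gh subrr mulr0z subr0.
  exact: (subgroup_span _ _ sK).1.
- move=> _ /allpairsP[[g j] /= [gT _ ->]]; apply: subgroupD.
  + exact: (cl_saturated _ _ sB).1.
  + by apply: sub_cl; exact: TB.
  + apply: subgroupMn; first exact: (cl_saturated _ _ sB).1.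
    by apply/clE; exists 1; rewrite mulr1z subrr; exact: sB.1.
- move=> x /clE[a Ka].
  pose j := `|(a %% p%:Z)%Z|%N; pose q := (a %/ p%:Z)%Z.
  have aE : a = q * p%:Z + j%:Z.
    by rewrite /j gez0_abs ?modz_ge0 -?divz_eq //; lia.
  have jp : (j < p)%N by rewrite -ltz_nat /j gez0_abs ?modz_ge0 ?ltz_pmod //; lia.
  have [g gT gx] : exists2 g, g \in T & span_mod K B (x - kappa *+ j - lam i *~ q - g).
    apply: covT.
    have -> : x - kappa *+ j - lam i *~ q =
        (x - kappa *~ a) - (lam i - kappa *+ p) *~ q.
      rewrite aE mulrzDr [q * _]mulrC mulrzA -!pmulrn mulrzBl opprB opprD.
      by rewrite [x + (_ - _)]addrA [x - _ - kappa *+ j]addrAC subrKA.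
    by apply: subgroupB => //; exact: subgroupMz.
  exists (g + kappa *+ j).
    by apply/allpairsP; exists (g, j); rewrite /= mem_iota add0n.
  rewrite finset.setUC; apply/span_setU1 => //; exists q.
  by move: gx; rewrite opprD addrA [_ - _ *~ q - g]addrAC [x - _ - g]addrAC.
- move=> _ _ /allpairsP[[g j] /= [gT + ->]] /allpairsP[[h k] /= [hT + ->]] /=.
  rewrite !mem_iota !add0n => jp kp; rewrite finset.setUC => /span_setU1 -/(_ iB)[b hs].
  by have [-> ->] := sep _ _ _ _ _ gT hT jp kp hs.
Qed.

End Transversals.

(** * Components over independent sublists as group elements *)

Section IndependentFamilies.
Variables (R : realType) (G : zmodType) (n : nat) (lam : 'I_n -> G).
Hypothesis fgG : fin_generated G.
Implicit Types (t u v : ambient R G) (K : set G) (A B S : {set 'I_n}).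
Local Notation comps := (comps lam).
Local Notation cl := (cl lam).
Local Notation span_mod := (span_mod lam).
Local Notation independent := (independent lam).
Local Notation transversal := (transversal lam).

(** Adjoining an element multiplies both numbers by the same [p]: every component splits into [p]
    components, and every representative is translated by [p] multiples of [kappa]. *)
Lemma comps_transversal K t S A : saturated K -> torus t -> independent K S ->
  A \subset S -> exists2 T, transversal K A T &
    \sum_(D \in comps K (coset K t) A) (1 : int) = (size T)%:Z.
Proof.
move=> satK tT indS; have sK := satK.1.
have [m] := ubnP #|A|; elim: m A => // m IHm A Am AS.
have [->|/finset.set0Pn[i iA]] := eqVneq A finset.set0.
  exists [:: 0]; first exact: transversal_set0.
  by rewrite comps_set0 // fsbig_set1.
pose B := (A :\ i)%SET; have iB : i \notin B by rewrite !inE eqxx.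
have AE : A = (B :|: [set i])%SET by rewrite finset.setUC finset.setD1K.
have BS : B \subset S by apply: fintype.subset_trans AS; exact: finset.subsetDl.
have [T TB sT] : exists2 T, transversal K B T &
    \sum_(D \in comps K (coset K t) B) (1 : int) = (size T)%:Z.
  by apply: IHm => //; move: Am; rewrite (finset.cardsD1 i) iA.
have satB := cl_saturated lam B sK.
have nBi : ~ cl K B (lam i).
  exact: independent_notin indS (fintype.subsetP AS i iA) iB BS.
have [kappa [p [p0 Kp nk KE]]] := primitive_step fgG satB nBi.
exists [seq g + kappa *+ j | g <- T, j <- iota 0 p].
  by rewrite AE; exact: transversal_step.
rewrite AE comps_sum_setU //.
rewrite (eq_fsbigr (fun=> p%:Z * 1)); last first.
  move=> D /set_mem [u [cu uB] ->]; rewrite mulr1.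
  exact: (comps_sum1 fgG satB cu.1 p0 nk Kp KE).
rewrite -fsbig_distrr; last exact: finite_comps.
by rewrite /= sT size_allpairs size_iota mulrC PoszM.
Qed.

Let sum_subset A S (x : 'I_n -> int) : A \subset S ->
  \sum_(i in A) lam i *~ x i =
  \sum_(i in S) lam i *~ (if i \in A then x i else 0).
Proof.
move=> AS; rewrite [RHS](bigID (mem A)) /= [X in _ + X]big1 ?addr0; last first.
  by move=> i /andP[_ /negbTE ->]; rewrite mulr0z.
apply: eq_big => [i|i /[dup] iA ->] //.
by case: (boolP (i \in A)) => [/(fintype.subsetP AS) ->|]; rewrite ?andbF.
Qed.

Let sumMn S (x : 'I_n -> int) N :
  (\sum_(i in S) lam i *~ x i) *+ N = \sum_(i in S) lam i *~ (x i * N%:Z).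
Proof. by rewrite -sumrMnl; apply: eq_bigr => i _; rewrite pmulrn mulrzA. Qed.

Let sumB S (x y : 'I_n -> int) :
  \sum_(i in S) lam i *~ (x i - y i) =
  \sum_(i in S) lam i *~ x i - \sum_(i in S) lam i *~ y i.
Proof. by rewrite -sumrB; apply: eq_bigr => i _; rewrite mulrzBr. Qed.

Let sumD S (x y : 'I_n -> int) :
  \sum_(i in S) lam i *~ (x i + y i) =
  \sum_(i in S) lam i *~ x i + \sum_(i in S) lam i *~ y i.
Proof. by rewrite -big_split; apply: eq_bigr => i _; rewrite mulrzDr. Qed.

Lemma independent_relation K S (x : 'I_n -> int) : saturated K ->
  independent K S -> K (\sum_(i in S) lam i *~ x i) ->
  forall i, i \in S -> x i = 0.
Proof.
move=> satK indS Kx i iS; have sK := satK.1.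
apply/eqP/negPn/negP => xi; apply: (indS i iS).
have satB := cl_saturated lam (S :\ i)%SET sK.
apply: (saturatedMz satB xi); apply: span_cl; exists (fun j => - x j).
move: Kx; rewrite (finset.big_setD1 i) //=.
under [X in _ -> K (_ - X)]eq_bigr do rewrite mulrNz.
by rewrite sumrN opprK.
Qed.

(* Modulo [K], some multiple [N g] is an integral combination of the [lam i];
   [B] collects the [i] whose coefficient is not divisible by [N]. *)
Lemma support_exists K S g : saturated K -> independent K S -> cl K S g ->
  exists2 B : {set 'I_n}, B \subset S & forall A, A \subset S ->
    (B \subset A <-> exists2 h, cl K A h & span_mod K S (g - h)).
Proof.
move=> satK indS [N N0 [a Ka]]; have sK := satK.1.
exists [set i in S | ~~ (N%:Z %| a i)%Z]%SET.
  by apply/fintype.subsetP => i; rewrite !inE => /andP[].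
move=> A AS; split=> [BA|[h [M M0 [b Kb]] [c Kc]]].
  (* Outside [A] the coefficients are divisible by [N]; subtracting the quotients moves [g] within
     its class to an element whose multiple involves only [A]. *)
  pose q i := if i \in A then 0 else (a i %/ N%:Z)%Z.
  exists (g - \sum_(i in S) lam i *~ q i); last first.
    by exists q; rewrite opprB [g + _]addrC subrK subrr; exact: sK.1.
  exists N => //; exists a.
  have -> : (g - \sum_(i in S) lam i *~ q i) *+ N - \sum_(i in A) lam i *~ a i =
      g *+ N - \sum_(i in S) lam i *~ a i; last exact: Ka.
  rewrite mulrnBl -addrA -opprD sumMn; congr (_ - _).
  rewrite (sum_subset a AS) -sumD; apply: eq_bigr => i iS; congr (_ *~ _).
  rewrite /q; case: ifPn => iA; first by rewrite mul0r add0r.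
  rewrite addr0 divzK //; apply: contraNT iA => Ni; apply: (fintype.subsetP BA).
  by rewrite inE iS.
apply/fintype.subsetP => i; rewrite inE => /andP[iS]; apply: contraNT => iA.
(* Clearing the denominators [N] and [M] gives a relation over [S]. For [i] outside [A] it reads
   [a i = c i * N], the divisibility wanted. *)
have /(_ i iS) : forall i, i \in S ->
    a i * M%:Z - ((if i \in A then b i else 0) * N%:Z + c i * (N * M)%N%:Z) = 0.
  apply: (independent_relation satK indS).
  have -> : \sum_(i in S) lam i *~ (a i * M%:Z -
        ((if i \in A then b i else 0) * N%:Z + c i * (N * M)%N%:Z)) =
      (h *+ M - \sum_(i in A) lam i *~ b i) *+ N +
      (g - h - \sum_(i in S) lam i *~ c i) *+ (N * M) -
      (g *+ N - \sum_(i in S) lam i *~ a i) *+ M.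
    rewrite (sum_subset b AS) !mulrnBl !sumMn sumB sumD -!mulrnA [(M * N)%N]mulnC.
    rewrite opprB [_ - _ + (_ - _ - _)]addrC [_ *+ _ - _ *+ _ - _]addrAC subrKA.
    by rewrite [RHS]addrC -[g *+ _ - _ - _]addrA subrKA opprD [- _ - _]addrC.
  by apply: subgroupB => //; [apply: subgroupD => //|]; exact: subgroupMn.
rewrite (negbTE iA) mul0r add0r => h0; apply/dvdzP; exists (c i).
have M0' : M%:Z != 0 by lia.
by apply: (mulIf M0'); move: h0; rewrite PoszM; lia.
Qed.

(** The map [phi] sends a representative over [A] to the one over [S] in its class. Its image
    consists of the classes that meet [cl K A], that is, those supported in [A]. *)
Lemma transversal_count K S A T T' (supp : G -> {set 'I_n}) : saturated K ->
  independent K S -> A \subset S -> transversal K S T -> transversal K A T' ->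
  (forall g, g \in T ->
    (supp g \subset A <-> exists2 h, cl K A h & span_mod K S (g - h))) ->
  size T' = count (fun g => supp g \subset A) T.
Proof.
move=> satK indS AS [uT TS covT sepT] [uT' T'A covT' sepT'] suppP.
have sK := satK.1; have sS := subgroup_span lam S sK.
have AS' : cl K A `<=` cl K S by apply: cl_sub => //; exact: sub_cl.
have SA : span_mod K A `<=` span_mod K S.
  apply: span_min => //; first exact: sub_span.
  by move=> i /(fintype.subsetP AS); exact: mem_span.
have /choice[phi phiP] : forall g, exists h, g \in T' ->
    h \in T /\ span_mod K S (g - h).
  move=> g; have [gT'|] := boolP (g \in T'); last by exists 0.
  by have [h hT gh] := covT g (AS' _ (T'A g gT')); exists h.
(* independence makes the span over [S] meet [cl K A] in the span over [A] *)
have spanSA x : cl K A x -> span_mod K S x -> span_mod K A x.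
  move=> [N N0 [b Kb]] [c Kc]; exists c.
  have c0 i : i \in S -> i \notin A -> c i = 0.
    move=> iS iA; have /(_ i iS) : forall i, i \in S ->
        c i * N%:Z - (if i \in A then b i else 0) = 0.
      apply: (independent_relation satK indS).
      have -> : \sum_(i in S) lam i *~ (c i * N%:Z - (if i \in A then b i else 0)) =
         (x *+ N - \sum_(i in A) lam i *~ b i) - (x - \sum_(i in S) lam i *~ c i) *+ N.
        rewrite (sum_subset b AS) mulrnBl sumMn sumB.
        by rewrite opprB [RHS]addrC subrKA.
      by apply: subgroupB => //; exact: subgroupMn.
    by rewrite (negbTE iA); nia.
  rewrite (sum_subset c AS).
  rewrite (eq_bigr (fun i => lam i *~ c i)) // => i iS.
  by case: ifPn => // /(c0 i iS) ->.
rewrite -size_filter -(size_map phi T'); apply: perm_size; apply: uniq_perm.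
- rewrite map_inj_in_uniq // => g h gT hT gh; apply: sepT' => //.
  apply: spanSA; first by apply: subgroupB; [exact: (cl_saturated _ _ sK).1|exact: T'A..].
  have := subgroupB sS (phiP g gT).2 (phiP h hT).2.
  by rewrite gh opprB addrA subrK.
- exact: filter_uniq.
- move=> g; rewrite mem_filter; apply/mapP/andP => [[h hT' ->]|[gA gT]].
    have [pT ps] := phiP h hT'; split=> //; apply/suppP => //.
    exists h; first exact: T'A.
    by rewrite -opprB; exact: subgroupN.
  have [h hA gh] := (suppP g gT).1 gA.
  have [k kT' hk] := covT' h hA; exists k => //.
  have [pT ps] := phiP k kT'; apply: sepT => //.
  have := subgroupD sS (subgroupD sS gh (SA _ hk)) ps.
  by rewrite !subrKA.
Qed.

End IndependentFamilies.

(** * Deletion, contraction and the sign pattern *)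

Section Positivity.
Variables (R : realType) (G : zmodType) (n : nat) (lam : 'I_n -> G).
Hypothesis fgG : fin_generated G.
Implicit Types (t u v : ambient R G) (K : set G) (A B S : {set 'I_n}).
Implicit Types (X : set (ambient R G)).
Local Notation comps := (comps lam).
Local Notation cl := (cl lam).
Local Notation independent := (independent lam).

Lemma alternating_sums_fsbig (I : choiceType) (D : set I) (F : I -> {poly int}) r :
  finite_set D -> (forall i, D i -> alternating_sums r (F i)) ->
  alternating_sums r (\sum_(i \in D) F i).
Proof.
move=> finD DF; rewrite fsbig_finite //= big_seq.
elim/big_ind: _ => [|p q|i]; [exact: alternating_sums0|exact: alternating_sumsD|].
by rewrite in_fset_set // inE; exact: DF.
Qed.

(* The characteristic polynomial, as a sum over sublists, of the arrangement
   induced on the coset [X] of [K] by the hypersurfaces indexed by [S]. *)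
Definition charpoly K X S : {poly int} :=
  \sum_(A : {set 'I_n} | A \subset S)
    (-1) ^+ #|A| *: \sum_(D \in comps K X A) ('X^(Defs.dim D) : {poly int}).

(** Deletion and contraction: the sublists containing [i] are evaluated separately inside each
    component of its hypersurface, and the additional element gives the minus sign. *)
Lemma charpoly_setU1 K t i S : saturated K -> torus t -> i \notin S ->
  charpoly K (coset K t) (i |: S)%SET =
  charpoly K (coset K t) S -
  \sum_(D \in comps K (coset K t) [set i]%SET) charpoly (cl K [set i]%SET) D S.
Proof.
move=> satK tT iS; rewrite /charpoly big_subset_setU1 //; congr (_ + _).
rewrite fsbig_finite; last exact: finite_comps.
rewrite exchange_big /= -sumrN; apply: eq_bigr => A AS.
have iA : i \notin A by apply: contra iS; exact: (fintype.subsetP AS).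
rewrite finset.cardsU1 iA exprS mulN1r scaleNr comps_sum_setU //; congr (- _).
rewrite -scaler_sumr; congr (_ *: _).
by rewrite fsbig_finite //; exact: finite_comps.
Qed.

(** The character is constant on the coset. If its value is 1, the hypersurface contains the coset
    and contraction cancels deletion; otherwise the hypersurface misses the coset and the
    contraction term is empty. *)
Lemma charpoly_mem K t i S : saturated K -> torus t -> i \notin S -> K (lam i) ->
  charpoly K (coset K t) (i |: S)%SET = 0 \/
  charpoly K (coset K t) (i |: S)%SET = charpoly K (coset K t) S.
Proof.
move=> satK tT iS Ki; rewrite charpoly_setU1 //.
have clE : cl K [set i]%SET = K by apply: cl_mem => // j; rewrite inE => /eqP ->.
have [ti|ti] := eqVneq (t (lam i)) 1.
  left; have -> : comps K (coset K t) [set i]%SET = [set coset K t].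
    apply/seteqP; split; first exact: comps_mem.
    move=> _ ->; exists t; last by rewrite clE.
    by split=> // j; rewrite inE => /eqP ->.
  by rewrite fsbig_set1 clE subrr.
right; have -> : comps K (coset K t) [set i]%SET = set0.
  apply/seteqP; split=> // D [u [[_ ut] uA] _]; move/eqP: ti; apply.
  by rewrite -ut // uA // inE.
by rewrite fsbig_set0 subr0.
Qed.

Lemma independent_basis K S A d : saturated K -> independent K S ->
  A \subset S -> has_basis K d -> (#|A| <= d)%N /\ has_basis (cl K A) (d - #|A|).
Proof.
move=> satK indS; have sK := satK.1.
have [m] := ubnP #|A|; elim: m A => // m IHm A Am AS hd.
have [->|/finset.set0Pn[i iA]] := eqVneq A finset.set0.
  by rewrite cl_set0 // finset.cards0 subn0.
pose B := (A :\ i)%SET; have iB : i \notin B by rewrite !inE eqxx.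
have AE : A = (B :|: [set i])%SET by rewrite finset.setUC finset.setD1K.
have BS : B \subset S by apply: fintype.subset_trans AS; exact: finset.subsetDl.
have cA : #|A| = #|B|.+1 by rewrite (finset.cardsD1 i) iA.
have [|Bd hB] := IHm B _ BS hd; first by rewrite -ltnS -cA.
have satB := cl_saturated lam B sK.
have nBi : ~ cl K B (lam i).
  exact: independent_notin indS (fintype.subsetP AS i iA) iB BS.
have [d' dE hd'] := has_basis_step R fgG satB nBi hB.
rewrite cA {1}AE -cl_cl //; split; first by rewrite ltnNge -subn_eq0 dE.
by rewrite subnS dE.
Qed.

Lemma has_basis_setT d : has_basis [set: G] d -> d = 0%N.
Proof.
case: d => // d [e [c [_ free]]].
by have := free (fun=> 1) I ord0 => /eqP; rewrite oner_eq0.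
Qed.

Lemma sum_powerset (U : {set 'I_n}) :
  \sum_(A : {set 'I_n} | A \subset U) (-1) ^+ #|A| *: 'X^(#|U| - #|A|) =
  ('X - 1 : {poly int}) ^+ #|U|.
Proof.
have [m] := ubnP #|U|; elim: m U => // m IHm U Um.
have [->|/finset.set0Pn[i iU]] := eqVneq U finset.set0.
  rewrite finset.cards0 (big_pred1 finset.set0); last first.
    by move=> A; rewrite /= finset.subset0.
  by rewrite finset.cards0 !expr0 scale1r.
pose V := (U :\ i)%SET; have iV : i \notin V by rewrite !inE eqxx.
have UE : U = (i |: V)%SET by rewrite finset.setD1K.
have cU : #|U| = #|V|.+1 by rewrite (finset.cardsD1 i) iU.
rewrite {1}UE big_subset_setU1 // cU exprS mulrBl mul1r -IHm; last first.
  by rewrite -ltnS -cU.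
rewrite mulr_sumr -sumrN; congr (_ + _); apply: eq_bigr => A AV.
  by rewrite subSn ?subset_leq_card // exprS scalerAr.
have iA : i \notin A by apply: contra iV; exact: (fintype.subsetP AV).
by rewrite finset.cardsU1 iA subSS exprS mulN1r scaleNr.
Qed.

Lemma sum_interval S B : B \subset S ->
  \sum_(A : {set 'I_n} | (A \subset S) && (B \subset A))
    (-1) ^+ #|A| *: 'X^(#|S| - #|A|) =
  (-1) ^+ #|B| *: ('X - 1 : {poly int}) ^+ (#|S| - #|B|).
Proof.
move=> BS; have cU : (#|S| - #|B| = #|(S :\: B)%SET|)%N.
  by rewrite finset.cardsD (finset.setIidPr BS).
rewrite cU -sum_powerset scaler_sumr.
rewrite (reindex_onto (fun A => (B :|: A)%SET) (fun A => (A :\: B)%SET)) /=.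
  apply: eq_big => A.
    rewrite finset.subsetUl andbT finset.subUset BS /= finset.subsetD.
    congr (_ && _); rewrite finset.setDUl finset.setDv finset.set0U.
    by apply/eqP/idP => [/finset.setDidPl|/finset.setDidPl].
  move=> /andP[_ /eqP AB].
  have BA0 : (B :&: A)%SET = finset.set0.
    by apply/setP => x; rewrite -AB !inE; case: (x \in B); rewrite ?andbF.
  rewrite finset.cardsU BA0 finset.cards0 subn0 exprD scalerA.
  by rewrite -cU subnDA.
move=> A /andP[_ BA]; apply/setP => x; rewrite !inE.
by case: (boolP (x \in B)) => [/(fintype.subsetP BA) ->|].
Qed.

(** The term of [A] has as multiplicity the number of [g] in the transversal with support in [A].
    After exchanging the sums, each [g] contributes an alternating sum over the sublists between its
    support and [S], which is a signed power of X - 1. *)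
Lemma charpoly_independent K t S d : saturated K -> torus t ->
  independent K S -> cl K S = [set: G] -> has_basis K d ->
  alternating_sums d (charpoly K (coset K t) S).
Proof.
move=> satK tT indS clS hd; have sK := satK.1.
(* Independence leaves rank [d - #|S|] modulo the closure, which is all of [G]. *)
have dS : #|S| = d.
  have [Sd] := independent_basis satK indS (fintype.subxx _) hd.
  by rewrite clS => /has_basis_setT; lia.
have [T trT _] := comps_transversal fgG satK tT indS (fintype.subxx S).
have [supp suppP] : exists supp : G -> {set 'I_n}, forall g, supp g \subset S /\
    forall A, A \subset S -> (supp g \subset A <->
      exists2 h, cl K A h & span_mod lam K S (g - h)).
  suff /choice[supp suppP] : forall g, exists B : {set 'I_n}, B \subset S /\
    forall A, A \subset S -> (B \subset A <->
      exists2 h, cl K A h & span_mod lam K S (g - h)) by exists supp.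
  move=> g; have [|B BS BP] := support_exists satK indS (g := g).
    by rewrite clS.
  by exists B.
suff -> : charpoly K (coset K t) S =
    \sum_(g <- T) (-1) ^+ #|supp g| *: ('X - 1) ^+ (d - #|supp g|).
  elim/big_ind: _ => [|p q|g _]; [exact: alternating_sums0|exact: alternating_sumsD|].
  have sd : (#|supp g| <= d)%N by rewrite -dS subset_leq_card // (suppP g).1.
  have := alternating_sums_XB1_exp (leq_subr #|supp g| d).
  by rewrite subKn.
transitivity (\sum_(g <- T) \sum_(A : {set 'I_n} | (A \subset S) && (supp g \subset A))
    (-1) ^+ #|A| *: 'X^(#|S| - #|A|) : {poly int}); last first.
  by apply: eq_bigr => g _; rewrite sum_interval ?dS // (suppP g).1.
rewrite (exchange_big_dep (fun A => A \subset S)) /=; last by move=> g A _ /andP[].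
apply: eq_bigr => A AS.
have [T' trT' sT'] := comps_transversal fgG satK tT indS AS.
have TE := transversal_count satK indS AS trT trT' (fun g _ => (suppP g).2 A AS).
have [Ad hA] := independent_basis satK indS AS hd.
rewrite (eq_fsbigr (fun=> (1 : int) *: 'X^(d - #|A|))); last first.
  move=> D /set_mem [u [cu _] ->]; rewrite scale1r.
  by rewrite (has_basis_dim fgG (cl_saturated lam A sK) cu.1 hA).
have fin : finite_set (comps K (coset K t) A) by exact: finite_comps.
move: sT'; rewrite !fsbig_finite //= -scaler_suml => ->.
rewrite TE AS /= big_const_seq iter_addr_0 dS scalerA mulrC -scalerA.
by rewrite -natz scaler_nat; congr (_ *+ _).
Qed.

(** Deleting a redundant [i] keeps the closure equal to [G], also over the enlarged subgroup of the
    contraction, so induction applies to both terms. The rank drops by one in the contraction, which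
    absorbs its minus sign. *)
Theorem charpoly_alternating K t S d : saturated K -> torus t ->
  cl K S = [set: G] -> has_basis K d ->
  alternating_sums d (charpoly K (coset K t) S).
Proof.
have [m] := ubnP #|S|; elim: m K t S d => // m IHm K t S d Sm satK tT clS hd.
have sK := satK.1.
have del i : i \in S -> (i |: S :\ i)%SET = S /\ (#|(S :\ i)%SET| < m)%N.
  by move=> iS; split; [rewrite finset.setD1K|move: Sm; rewrite (finset.cardsD1 i) iS].
have notin i : i \notin (S :\ i)%SET by rewrite !inE eqxx.
have clT K' A : subgroup K' -> K `<=` K' ->
    (forall i, i \in S -> cl K' A (lam i)) -> cl K' A = [set: G].
  move=> sK' KK' SA; apply/seteqP; split=> // x _.
  have : cl K S x by rewrite clS.
  apply: cl_min => //; first exact: cl_saturated.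
  by move=> y /KK'; exact: sub_cl.
have [[i [iS iP]]|nred] := pselect (exists i, i \in S /\ cl K (S :\ i)%SET (lam i)).
  have [SE Si] := del i iS.
  have delT : cl K (S :\ i)%SET = [set: G].
    apply: clT => // j jS; have [->//|ji] := eqVneq j i.
    by apply: mem_cl; rewrite // !inE ji.
  have pS := IHm K t _ d Si satK tT delT hd.
  have [Ki|nKi] := pselect (K (lam i)).
    by have [] := charpoly_mem satK tT (notin i) Ki; rewrite SE => ->;
      [exact: alternating_sums0|].
  rewrite -SE charpoly_setU1 //; apply: alternating_sumsD => //.
  have [d' -> hd'] := has_basis_step R fgG satK nKi hd.
  apply: alternating_sums_shift; apply: alternating_sums_fsbig.
    exact: finite_comps.
  move=> _ [u [cu uA] ->].
  have sat' := cl_saturated lam [set i]%SET sK.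
  apply: IHm => //; first exact: cu.1.
  apply: clT; [exact: sat'.1|exact: sub_cl|move=> j jS].
  have [->|ji] := eqVneq j i; last by apply: mem_cl; rewrite ?inE ?ji //; exact: sat'.1.
  by apply: sub_cl; apply: mem_cl => //; rewrite inE.
apply: charpoly_independent => // i iS Ki; apply: nred; by exists i.
Qed.

End Positivity.

(** * Uniqueness of the Moebius function on comparable pairs *)

Section MobiusUniqueness.
Variables (T : choiceType) (L : set (set T)).
Hypothesis finL : finite_set L.

(** The defining relation at [Y] determines the value there from the values at the strictly larger
    members inside [X], whose intervals are shorter. *)
Lemma mobius_uniq (mu mu' : set T -> set T -> int) :
  is_mobius L mu -> is_mobius L mu' ->
  forall X Y, L X -> L Y -> Y `<=` X -> mu X Y = mu' X Y.
Proof.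
move=> hmu hmu' X Y LX; pose I Y := [set Z | L Z /\ Y `<=` Z /\ Z `<=` X].
have finI Z : finite_set (I Z) by apply: sub_finite_set finL => W [].
pose e Z := finmap.enum_fset (fset_set (I Z)).
have eE Z W : (W \in e Z) = (W \in I Z) by rewrite in_fset_set.
have [m] := ubnP (size (e Y)); elim: m Y => // m IHm Y Im LY YX.
have IY : I Y Y by split=> //; split.
have := hmu X Y LX LY YX; rewrite -[RHS](hmu' X Y LX LY YX).
change ((\sum_(Z \in I Y) mu X Z = \sum_(Z \in I Y) mu' X Z) -> mu X Y = mu' X Y).
rewrite (fsbigD1 Y) // [in RHS](fsbigD1 Y) //=.
rewrite (eq_fsbigr (fun Z => mu' X Z)); first exact: addIr.
move=> Z /set_mem [[LZ [YZ ZX]] /= ZY]; apply: IHm => //.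
apply: leq_trans (_ : size (Y :: e Z) <= m)%N => //.
apply: leq_trans (_ : size (e Y) <= m)%N => //.
apply: uniq_leq_size => [|W].
  rewrite /= finmap.fset_uniq andbT eE; apply/negP => /set_mem [_ [ZY' _]].
  by apply: ZY; apply/seteqP.
rewrite in_cons eE => /orP[/eqP ->|]; first by rewrite eE; apply/mem_set.
rewrite eE => /set_mem [LW [ZW WX]]; apply/mem_set; split=> //; split=> //.
exact: subset_trans ZW.
Qed.

End MobiusUniqueness.

(** * Finiteness of the set of torus components *)

Section TorusComponents.
Variables (R : realType) (G : zmodType).
Hypothesis fgG : fin_generated G.
Implicit Types (t u v : ambient R G).

Definition components : set (set (ambient R G)) :=
  [set X | exists2 u, torus u & X = coset (tors (G:=G)) u].

(** A component is determined by the values of its characters at finitely many torsion generators,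
    and these values are roots of unity of one common order. *)
Lemma finite_components : finite_set components.
Proof.
have satT := @tors_saturated G; have sT := satT.1.
have [d [e [c bT]]] := basis_exists satT fgG.
have [m [s sG]] := fgG.
(* The torsion part of a generator. A torsion element has zero coordinates, so its expression in the
   generators holds verbatim with the [tau j]. *)
pose tau j := tnth s j - \sum_i e i *~ c (tnth s j) i.
have tauT j : tors (tau j) by exact: bT.1.
have gen x : tors x -> exists a : 'I_m -> int, x = \sum_j tau j *~ a j.
  move=> Tx; have : [set: G] x by [].
  rewrite -sG => -[a xE]; exists a.
  have {}xE : x = \sum_j tnth s j *~ a j.
    by rewrite xE; apply: eq_bigl => j; rewrite inE.
  rewrite /tau; under eq_bigr do rewrite mulrzBl.
  rewrite sumrB -xE; suff -> : \sum_j (\sum_i e i *~ c (tnth s j) i) *~ a j = 0.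
    by rewrite subr0.
  under eq_bigr do rewrite mulrz_suml.
  rewrite exchange_big big1 // => i _ /=.
  under eq_bigr do rewrite -mulrzA.
  rewrite -mulrz_sumr; suff -> : \sum_j c (tnth s j) i * a j = 0 by rewrite mulr0z.
  transitivity (c x i); last exact: (coord_eq0P sT bT x).1.
  rewrite xE; elim/big_rec2: _ => [|j y z _ ->].
    by rewrite (coord0 sT bT).
  by rewrite (coordD sT bT) (coordMz sT bT).
have /choice[N NP] : forall j, exists k, (0 < k)%N /\ tau j *+ k = 0.
  by move=> j; have [k k0 kE] := tauT j; exists k.
pose M := (\prod_j N j)%N.
have M0 : (0 < M)%N by rewrite prodn_gt0 // => j; have [] := NP j.
have [r [ur sr rE]] := roots_of_unity_enum R[i] M0.
apply: (@sub_finite_set _ _ [set (fun f : {ffun 'I_m -> 'I_(size r).+1} =>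
  [set u | torus u /\ forall j, u (tau j) = r`_(f j)]) f | f in setT]).
  move=> _ [u uT ->].
  exists [ffun j => inord (index (u (tau j)) r)] => //.
  have ur' j : r`_([ffun j => inord (index (u (tau j)) r)] j : 'I_(size r).+1) = u (tau j).
    rewrite ffunE inordK ?ltnS ?index_size // nth_index // rE.
    by rewrite -torusMn // /M (bigD1 j) //= mulrnA (NP j).2 mul0rn torus0.
  apply/seteqP; split=> v [vT vu]; split=> //.
    move=> x /gen[a ->]; rewrite !torus_sum //; apply: eq_bigr => j _.
    by rewrite !torusMz // vu ur'.
  by move=> j; rewrite ur' vu.
apply: finite_image; exact: finite_finset.
Qed.

End TorusComponents.

(** * The Moebius function of the layers as a sum over sublists *)

Section Layers.
Variables (R : realType) (G : zmodType) (n : nat) (E : n.-tuple G).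
Hypothesis fgG : fin_generated G.
Local Notation lam := (tnth E).
Local Notation T := (@tors G).
Local Notation L := (@layers R G n E).
Implicit Types (t u v : ambient R G) (K : set G) (A B S : {set 'I_n}).
Implicit Types (X Y Z D : set (ambient R G)).
Let satT : saturated T := @tors_saturated G.
Let sT := satT.1.

Lemma layersP D : L D <-> exists A, exists2 t,
  torus t /\ (forall i, i \in A -> t (lam i) = 1) & D = coset (cl lam T A) t.
Proof.
split=> -[A [t tA ->]]; exists A, t.
- exact/intersectionP.
- by rewrite component_intersection.
- exact/intersectionP.
- by rewrite component_intersection //; apply/intersectionP.
Qed.

Lemma comps_layer A0 t A D : torus t -> (forall i, i \in A0 -> t (lam i) = 1) ->
  comps lam (cl lam T A0) (coset (cl lam T A0) t) A D -> L D.
Proof.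
move=> tT tA [u [cu uA] ->]; apply/layersP; exists (A0 :|: A)%SET, u.
  split=> [|i]; first exact: cu.1.
  rewrite inE => /orP[iA|]; last exact: uA.
  by rewrite cu.2 ?tA //; exact: mem_cl.
by rewrite cl_cl.
Qed.

Lemma finite_layers : finite_set L.
Proof.
apply: (@sub_finite_set _ _ (\bigcup_(A in [set: {set 'I_n}])
    \bigcup_(X in @components R G) comps lam T X A)).
  move=> _ /layersP[A [t [tT tA] ->]]; exists A => //.
  by exists (coset T t); [exists t|exists t].
apply: bigcup_finite => [|A _]; first exact: finite_finset.
apply: bigcup_finite => [|_ [u uT ->]]; first exact: finite_components.
exact: finite_comps.
Qed.

Lemma torus_component_coset K t : T `<=` K -> torus t ->
  torus_component (coset K t) = coset T t.
Proof.
move=> TK tT; have torusE : @torus R G = intersection E finset.set0.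
  apply/seteqP; split=> u; last by move=> /intersectionP[].
  by move=> uT; apply/intersectionP; split=> // i; rewrite inE.
have cE u : torus u -> connected_component (@torus R G) u = coset T u.
  move=> uT; rewrite {1}torusE component_intersection //; last by rewrite -torusE.
  by rewrite cl_set0.
apply/seteqP; split=> [v [u [uT ut]]|v tv].
  by rewrite cE // -(@coset_eq _ _ T t u) //; split=> // x /TK; exact: ut.
by exists t => //; rewrite cE.
Qed.

(* The subgroup [K] of which the layer [X] is a coset. *)
Definition constant_on X : set G :=
  [set x | forall u v, X u -> X v -> u x = v x].

Lemma constant_on_coset K t : saturated K -> torus t ->
  constant_on (coset K t) = K.
Proof.
move=> satK tT; apply/seteqP; split=> x; last first.
  by move=> Kx u v [_ ->] // [_ ->].
move=> cx; apply: contrapT => nKx.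
have [u cu] := coset_separates satK fgG tT nKx.
by rewrite (cx u t cu) ?eqxx //; split.
Qed.

(** Constant characters are excluded because one that is identically 1 on [X] would make the
    alternating sum over sublists cancel even at [X] itself. *)
Definition nonconstant X : {set 'I_n} := [set i | ~~ `[< constant_on X (lam i) >]]%SET.

(** Whitney's sublist expansion, adapted to intersections with several components: a sublist
    contributes its sign to each of them. *)
Definition sublist_mobius X D : int :=
  \sum_(A : {set 'I_n} | A \subset nonconstant X)
    (if `[< comps lam (constant_on X) X A D >] then (-1) ^+ #|A| else 0).

Lemma sum_sign_powerset (U : {set 'I_n}) :
  \sum_(A : {set 'I_n} | A \subset U) (-1) ^+ #|A| = (U == finset.set0)%:R :> int.
Proof.
have := congr1 (fun p : {poly int} => p.[1]) (sum_powerset U).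
rewrite horner_sum hornerE /= !hornerE subrr => h.
rewrite -finset.cards_eq0 -expr0n -[RHS]h; apply: eq_bigr => A _.
by rewrite !hornerE expr1n mulr1.
Qed.

Lemma fsbig_if (I : choiceType) (V : nmodType) (D B : set I) (F : I -> V) :
  B `<=` D -> \sum_(x \in D) (if `[< B x >] then F x else 0) = \sum_(x \in B) F x.
Proof.
move=> BD; rewrite -(@fsbig_widen _ _ _ _ B D) //.
  by apply: eq_fsbigr => x /set_mem Bx; rewrite asboolT.
by move=> x [_ nB] /=; rewrite asboolF.
Qed.

(** If all characters of [A] are identically 1 on [Y], exactly one component over [A] contains [Y],
    the one through [y]; otherwise none does. What remains is a sum of signs over all subsets of one
    index set, and this set is empty exactly when [Y] is [X]. *)
Lemma sublist_mobiusP : is_mobius L sublist_mobius.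
Proof.
move=> X Y /layersP[A0 [t [tT tA0] XE]] /layersP[B [y [yT yB] YE]] YX.
set K := cl lam T A0 in XE; have satK : saturated K := cl_saturated lam A0 sT.
set K' := cl lam T B in YE; have satK' : saturated K' := cl_saturated lam B sT.
have cX : constant_on X = K by rewrite XE constant_on_coset.
have cY : constant_on Y = K' by rewrite YE constant_on_coset.
have Yy : Y y by rewrite YE.
have Xy : X y by exact: YX.
have KK' : K `<=` K' by rewrite -cX -cY => x h u v /YX Xu /YX Xv; exact: h.
have XyE : coset K y = X by rewrite XE; apply: coset_eq; rewrite -XE.
set I := [set Z | _]; pose J := [set i | `[< K' (lam i) >] && (y (lam i) == 1)]%SET.
have JP A : (A \subset J) <-> (forall u i, Y u -> i \in A -> u (lam i) = 1).
  split=> [/fintype.subsetP AJ u i Yu /AJ|h].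
    rewrite inE => /andP[/asboolP Ki /eqP yi].
    by move: Yu; rewrite YE => -[_ ->].
  apply/fintype.subsetP => i iA; rewrite inE (h y i Yy iA) eqxx andbT.
  by apply/asboolP; rewrite -cY => u v Yu Yv; rewrite !h.
have finI : finite_set I by apply: sub_finite_set finite_layers => Z [].
rewrite fsbig_finite // /sublist_mobius exchange_big /= cX.
transitivity (\sum_(A : {set 'I_n} | A \subset (nonconstant X :&: J)%SET)
    (-1) ^+ #|A| : int).
  rewrite [RHS](eq_bigl (fun A => (A \subset nonconstant X) && (A \subset J)));
    last by move=> A; rewrite finset.subsetI.
  rewrite [RHS]big_mkcondr; apply: eq_bigr => A AS.
  rewrite -(fsbig_finite _ _ finI); case: ifPn => AJ.
    pose Z0 := coset (cl lam K A) y.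
    have /JP yA := AJ.
    have Z0A : comps lam K X A Z0 by exists y; [split=> // i; exact: yA|].
    have IZ0 : I Z0.
      split; first by apply: (@comps_layer A0 t A); rewrite -?XE.
      split; last by rewrite -XyE; apply: coset_sub; exact: sub_cl.
      rewrite YE; apply: coset_sub; apply: cl_min => // i iA.
      by rewrite -cY => u v Yu Yv; rewrite !yA.
    rewrite (fsbigD1 Z0) //= asboolT // fsbig1 ?addr0 // => Z [[_ [YZ _]] /= ZZ0].
    rewrite asboolF // => -[u [_ _] ZE]; apply: ZZ0; rewrite ZE /Z0.
    by apply/esym/coset_eq; rewrite -ZE; exact: YZ.
  rewrite fsbig1 // => Z [_ [YZ _]]; rewrite asboolF // => -[u [_ uA] ZE].
  move/negP: AJ; apply; apply/JP => v i /YZ; rewrite ZE => -[_ vu] iA.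
  by rewrite vu ?uA //; exact: mem_cl satK.1 iA.
rewrite sum_sign_powerset; congr (nat_of_bool _)%:R; apply/eqP/eqP => [SJ|XY].
  apply/seteqP; split; last exact: YX.
  rewrite -XyE YE; apply: coset_sub; apply: cl_min => // [|i iB].
    exact: sub_cl.
  have iJ : i \in J.
    by rewrite inE yB // eqxx andbT; apply/asboolP; exact: mem_cl.
  have : i \notin (nonconstant X :&: J)%SET by rewrite SJ inE.
  by rewrite inE iJ andbT inE negbK cX => /asboolP.
apply/setP => i; rewrite !inE; apply/negbTE/negP => /andP[/asboolP nK /andP[/asboolP Ki _]].
by apply: nK; rewrite XY cY.
Qed.

Lemma mobius_sublist X D : L X -> L D -> D `<=` X ->
  mobius L X D = sublist_mobius X D.
Proof.
apply: mobius_uniq; [exact: finite_layers| |exact: sublist_mobiusP].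
by rewrite /mobius; apply: xgetPex; exists sublist_mobius; exact: sublist_mobiusP.
Qed.

Lemma component_layer X : components X -> L X.
Proof.
move=> [t tT ->]; apply/layersP; exists finset.set0, t; last by rewrite cl_set0.
by split=> // i; rewrite inE.
Qed.

(** Every layer lies in exactly one component of the torus, which is also the first argument of its
    Moebius value; inside that component the two sums are exchanged. *)
Lemma toric_char_polyE : toric_char_poly R E =
  \sum_(X \in @components R G) charpoly lam T X (nonconstant X).
Proof.
transitivity (\sum_(D \in L)
    sublist_mobius (torus_component D) D *: ('X^(Defs.dim D) : {poly int})).
  apply: eq_fsbigr => D /set_mem LD; have /layersP[A [u [uT _] DE]] := LD.
  rewrite mobius_sublist // DE torus_component_coset //.
  - by apply: component_layer; exists u.
  - exact: sub_cl.
  - by apply: coset_sub; exact: sub_cl.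
  - exact: sub_cl.
have -> : L = \bigcup_(X in @components R G) [set D | L D /\ D `<=` X].
  apply/seteqP; split=> [D LD|D [X _ []//]].
  have /layersP[A [t [tT _] DE]] := LD.
  exists (coset T t); first by exists t.
  by split=> //; rewrite DE; apply: coset_sub; exact: sub_cl.
have finLX X : finite_set [set D | L D /\ D `<=` X].
  by apply: sub_finite_set finite_layers => D [].
rewrite fsbig_bigcup_disjoint //; first last.
- move=> _ _ D [u uT ->] [v vT ->] [/layersP[A [w [wT _] DE]] Du] [_ Dv].
  have Dw : D w by rewrite DE.
  by rewrite -(coset_eq (Du w Dw)) (coset_eq (Dv w Dw)).
- exact: finite_components.
apply: eq_fsbigr => X /set_mem CX; have LX := component_layer CX.
have [t tT XE] := CX.
rewrite (eq_fsbigr (fun D => \sum_(A : {set 'I_n} | A \subset nonconstant X)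
    (if `[< comps lam T X A D >] then (-1) ^+ #|A| *: 'X^(Defs.dim D) else 0))).
  rewrite fsbig_finite // exchange_big /=; apply: eq_bigr => A _.
  rewrite -(fsbig_finite _ _ (finLX X)) fsbig_if //.
    rewrite !fsbig_finite ?scaler_sumr //; rewrite XE; exact: finite_comps.
  move=> D DA; rewrite XE in DA *; split; last exact: comps_sub DA.
  rewrite -(cl_set0 lam satT) in DA; apply: comps_layer tT _ DA => i.
  by rewrite inE.
move=> D /set_mem [LD DX]; have /layersP[A [u [uT _] DE]] := LD.
have Xu : coset T t u by rewrite -XE; apply: DX; rewrite DE.
have -> : torus_component D = X.
  by rewrite DE torus_component_coset ?(coset_eq Xu) //; exact: sub_cl.
rewrite /sublist_mobius scaler_suml; apply: eq_bigr => B _.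
have -> : constant_on X = T by rewrite XE constant_on_coset.
by case: ifP; rewrite ?scale0r.
Qed.

End Layers.

(** * Rank of the group and bases modulo torsion *)

Section Rank.
Variables (R : realType) (G : zmodType) (n : nat) (E : n.-tuple G).
Hypothesis fgG : fin_generated G.
Local Notation lam := (tnth E).
Local Notation T := (@tors G).
Let satT : saturated T := @tors_saturated G.
Let sT := satT.1.

Lemma freeZ_independent r (s : r.-tuple G) : freeZ s ->
  independent (tnth s) T [set: 'I_r]%SET.
Proof.
move=> fs i _ [k k0 [c [l l0]]]; rewrite mulrnBl -mulrnA => /eqP.
rewrite subr_eq0 => /eqP kl.
suff : (k * l)%N%:Z = 0 by move=> /eqP; rewrite eqz_nat; lia.
have := fs (fun j => if j == i then (k * l)%N%:Z else - (c j * l%:Z)) _ i.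
rewrite eqxx; apply; rewrite (bigD1 i) //= eqxx -pmulrn kl.
rewrite -sumrMnl; apply/eqP; rewrite addr_eq0 -sumrN; apply/eqP.
apply: eq_big => [j|j]; rewrite !inE ?andbT // => /negbTE ->.
by rewrite mulrNz opprK pmulrn mulrzA.
Qed.

(** A basis modulo torsion is a free tuple, so its length is at most [r]; the independent family [s]
    gives the converse. Modulo the closure of [s] the rank is then 0. *)
Lemma free_tuple_cl r (s : r.-tuple G) : is_rank [set: G] r -> freeZ s ->
  has_basis T r /\ cl (tnth s) T [set: 'I_r]%SET = [set: G].
Proof.
move=> [_ rmax] fs; have [d [e [c bT]]] := basis_exists satT fgG.
have hd : has_basis T d by exists e, c.
have dr : (d <= r)%N.
  apply: (rmax d [tuple e i | i < d]) => // c' e0.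
  apply: bT.2; exists 1%N => //; rewrite mulr1n -[RHS]e0.
  by apply: eq_bigr => i _; rewrite tnth_mktuple.
have [] := independent_basis R fgG satT (freeZ_independent fs) (fintype.subxx _) hd.
rewrite finset.cardsT card_ord => rd; have {dr rd} dE : d = r by apply/eqP; rewrite eqn_leq dr.
rewrite dE subnn => -[e' [c' [b' _]]]; split; first by rewrite -dE.
apply/seteqP; split=> // x _.
by have := b' x; rewrite big_ord0 subr0.
Qed.

Lemma spanZ_sub_cl (S : {set 'I_n}) x : (forall i, i \notin S -> T (lam i)) ->
  spanZ E [set: 'I_n]%SET x -> cl lam T S x.
Proof.
move=> ST [c ->]; have sS := (cl_saturated lam S sT).1.
apply: subgroup_sum => // i _; apply: subgroupMz => //.
by have [iS|/ST] := boolP (i \in S); [exact: mem_cl|exact: sub_cl].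
Qed.

(** The list spans [r] independent elements, whose closure is already [G]; torsion elements missing
    from [S] lie in the base subgroup anyway. *)
Lemma full_rank_cl r (S : {set 'I_n}) : is_rank [set: G] r ->
  is_rank (spanZ E [set: 'I_n]%SET) r -> (forall i, i \notin S -> T (lam i)) ->
  has_basis T r /\ cl lam T S = [set: G].
Proof.
move=> rG [[s fs sE] _] ST; have [hr cls] := free_tuple_cl rG fs; split=> //.
apply/seteqP; split=> // x _; have : cl (tnth s) T [set: 'I_r]%SET x by rewrite cls.
apply: cl_min => [||i _]; [exact: cl_saturated|exact: sub_cl|].
exact: spanZ_sub_cl.
Qed.

End Rank.

Theorem corollary3p4 (R : realType) (G : zmodType) (n : nat) (E : n.-tuple G)
    (rk m : {set 'I_n} -> nat) (r : nat)
    (hG : fin_generated G) (hE : represents E rk m)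
    (hr : r = rk [set: 'I_n]%SET) (hrG : is_rank [set: G]%classic r) :
  exists a : nat -> int,
    toric_char_poly R E = \sum_(i < r.+1) a i *: 'X^(r - i) /\
    forall k : nat, (k <= r)%N ->
      0 <= (-1) ^+ k * a k /\
      0 <= (-1) ^+ k * \sum_(i < k.+1) a i.
Proof.
have [rE _] := hE [set: 'I_n]%SET; rewrite -hr in rE.
apply: alternating_sumsP; rewrite toric_char_polyE //.
apply: alternating_sums_fsbig => [|_ [t tT ->]]; first exact: finite_components.
have satT := @tors_saturated G.
(* The elements left out are constant on a component of the torus, hence torsion. *)
have [|hT clT] := @full_rank_cl R _ _ _ hG r (nonconstant E (coset (@tors G) t)) hrG rE.
  by move=> i; rewrite inE negbK constant_on_coset // => /asboolP.
exact: charpoly_alternating.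
Qed.
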